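(* Let $Y$ be a Polish space and $B$ an analytic digraph on $Y$. Then exactly one of the following holds: (a) $(Y,B)$ has countable Borel chromatic number; (b) there is a complex situation $(X,(f_n))$ such that $(X,A^f)\preceq^{inj}_c(Y,B)$ or $(X,A^f)\preceq^{inj}_c(Y,B^{-1})$.
   Context: A digraph on $X$ is a relation $A\subseteq X^2$ disjoint from the diagonal $\Delta(X)$; $B^{-1}=\{(x,y):(y,x)\in B\}$. $(X,A)\preceq^{inj}_c(Y,B)$ means there is an injective continuous $h:X\to Y$ with $A\subseteq(h\times h)^{-1}(B)$. The Borel chromatic number of a digraph $A$ on Polish $X$ is the least cardinality of a Polish $Y$ admitting a Borel $c:X\to Y$ with $c(x)\neq c(x')$ for $(x,x')\in A$. For a sequence $(f_n)$ of partial functions, $A^f:=\bigcup_n\mathrm{Graph}(f_n)$. A complex situation is a pair $(X,(f_n)_{n\in\omega})$ where $X$ is a nonempty Polish space, each $f_n$ is a partial continuous open map on $X$ whose domain and range are open in $X$, and $\Delta(X)\subseteq\overline{A^f}\setminus A^f$. *)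

(* Defs.v *)
From Stdlib Require Import Reals Classical.
Open Scope R_scope.

Record is_metric (X : Type) (d : X -> X -> R) : Prop := {
  m_nonneg : forall x y, 0 <= d x y;
  m_refl : forall x, d x x = 0;
  m_sep : forall x y, d x y = 0 -> x = y;
  m_sym : forall x y, d x y = d y x;
  m_tri : forall x y z, d x z <= d x y + d y z }.

Definition cauchy {X : Type} (d : X -> X -> R) (u : nat -> X) : Prop :=
  forall eps, eps > 0 -> exists N, forall n m, (n >= N)%nat -> (m >= N)%nat -> d (u n) (u m) < eps.

Definition converges {X : Type} (d : X -> X -> R) (u : nat -> X) (l : X) : Prop :=
  forall eps, eps > 0 -> exists N, forall n, (n >= N)%nat -> d (u n) l < eps.

Definition complete_metric {X : Type} (d : X -> X -> R) : Prop :=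
  forall u, cauchy d u -> exists l, converges d u l.

(** Separable: a countable dense subset (given as an enumeration with gaps,
    so that the empty space is allowed). *)
Definition separable_metric {X : Type} (d : X -> X -> R) : Prop :=
  exists s : nat -> option X,
    forall x eps, eps > 0 -> exists n y, s n = Some y /\ d x y < eps.

Record Polish := {
  pt :> Type;
  dist : pt -> pt -> R;
  dist_metric : is_metric pt dist;
  dist_complete : complete_metric dist;
  dist_separable : separable_metric dist }.

Arguments dist {p}.

Definition is_open {X : Polish} (U : X -> Prop) : Prop :=
  forall x, U x -> exists eps, eps > 0 /\ forall y, dist x y < eps -> U y.

Definition continuous {X Y : Polish} (f : X -> Y) : Prop :=
  forall x eps, eps > 0 -> exists delta, delta > 0 /\
    forall x', dist x x' < delta -> dist (f x) (f x') < eps.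

Inductive borel {X : Polish} : (X -> Prop) -> Prop :=
  | borel_open : forall U, is_open U -> borel U
  | borel_compl : forall A, borel A -> borel (fun x => ~ A x)
  | borel_union : forall F : nat -> X -> Prop,
      (forall n, borel (F n)) -> borel (fun x => exists n, F n x)
  | borel_ext : forall A B, (forall x, A x <-> B x) -> borel A -> borel B.

Definition borel_map_nat {X : Polish} (c : X -> nat) : Prop :=
  forall n, borel (fun x => c x = n).

Definition digraph {X : Type} (A : X -> X -> Prop) : Prop :=
  forall x, ~ A x x.

Definition inv_rel {X : Type} (B : X -> X -> Prop) : X -> X -> Prop :=
  fun x y => B y x.

(** Analytic subset of Y^2: continuous image of a Polish space
    (Y^2 with the product topology). *)
Definition analytic_rel {Y : Polish} (B : Y -> Y -> Prop) : Prop :=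
  exists (Z : Polish) (g1 g2 : Z -> Y),
    continuous g1 /\ continuous g2 /\
    forall y y', B y y' <-> exists z, g1 z = y /\ g2 z = y'.

(** Countable Borel chromatic number: a Borel coloring with values in a
    countable Polish space, equivalently in nat. *)
Definition countable_borel_chromatic {Y : Polish} (B : Y -> Y -> Prop) : Prop :=
  exists c : Y -> nat, borel_map_nat c /\ forall y y', B y y' -> c y <> c y'.

Definition inj_c_le {X Y : Polish} (A : X -> X -> Prop) (B : Y -> Y -> Prop) : Prop :=
  exists h : X -> Y, (forall x x', h x = h x' -> x = x') /\ continuous h /\
    forall x x', A x x' -> B (h x) (h x').

(** Partial map on X: domain D and a total function f used only on D. *)
Record pmap (X : Type) := { pdom : X -> Prop; pfun : X -> X }.
Arguments pdom {X}.
Arguments pfun {X}.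

Definition prange {X : Type} (p : pmap X) : X -> Prop :=
  fun y => exists x, pdom p x /\ pfun p x = y.

Definition pcontinuous {X : Polish} (p : pmap X) : Prop :=
  forall x eps, pdom p x -> eps > 0 -> exists delta, delta > 0 /\
    forall x', pdom p x' -> dist x x' < delta -> dist (pfun p x) (pfun p x') < eps.

(** Openness of p: images of relatively open subsets of the (open) domain
    are open (these are exactly the open subsets of X contained in D). *)
Definition popen {X : Polish} (p : pmap X) : Prop :=
  forall U : X -> Prop, is_open U -> (forall x, U x -> pdom p x) ->
    is_open (fun y => exists x, U x /\ pfun p x = y).

Definition Af {X : Type} (f : nat -> pmap X) : X -> X -> Prop :=
  fun x y => exists n, pdom (f n) x /\ pfun (f n) x = y.

Definition in_closure2 {X : Polish} (A : X -> X -> Prop) (x y : X) : Prop :=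
  forall eps, eps > 0 -> exists x' y', A x' y' /\ dist x x' < eps /\ dist y y' < eps.

Definition complex_situation (X : Polish) (f : nat -> pmap X) : Prop :=
  inhabited X /\
  (forall n, is_open (pdom (f n)) /\ is_open (prange (f n)) /\
             pcontinuous (f n) /\ popen (f n)) /\
  (forall x, in_closure2 (Af f) x x /\ ~ Af f x x).

(* Main.v *)
(** Let [B] be analytic without a countable Borel colouring. A fusion in the style of
    Bernshteyn's proof of the G0 dichotomy gives a continuous [h] from the Cantor space to [Y]
    mapping the edges [(s_n 0 z, s_n 1 z)] into [B]; the fusion also decides, for any two words
    [s], [t] of the same length, whether [h (s z) = h (t z)] for all [z] (the words are twins)
    or [h] has disjoint images on the two cones. A word splits when its two one-digit
    extensions are not twins, and the sequences that take the digit 0 after every nonsplitting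
    word form a closed set on which [h] is injective without losing range.

    Let [(p, q)] be such that [(h (p z), h (q z))] is always in [B]. If no extension of [q]
    splits without the corresponding extension of [p] splitting, then replacing [p] by [q]
    induces an open partial map on that closed set. If such pairs are dense, they form a
    complex situation below [B]; if the reversed pairs are dense in some cone, a complex
    situation below the inverse of [B]. Otherwise, inside a smaller cone, either end of a pair
    can always be prolonged so that it splits while the other end does not; this allows a
    second fusion whose limit is injective, and then every pair is good. The two alternatives
    exclude each other by a Baire category argument. *)

From Corelib Require Import ssreflect ssrfun.
From Stdlib Require Import Reals Classical ClassicalEpsilon FunctionalExtensionality
  ProofIrrelevance Lra Lia List Cantor.
Require Import Defs.
Import ListNotations.
Set Bullet Behavior "None".
Open Scope R_scope.

(** * Choice and metric preliminaries *)

Lemma choice_fun {A B : Type} (R : A -> B -> Prop) :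
  (forall a, exists b, R a b) -> exists f, forall a, R a (f a).
Proof.
move=> H; exists (fun a => proj1_sig (constructive_indefinite_description _ (H a))) => a.
by case: constructive_indefinite_description.
Qed.

Lemma dep_choice {A : Type} (P : nat -> A -> Prop) (R : nat -> A -> A -> Prop) a0 :
  P 0%nat a0 -> (forall n a, P n a -> exists b, P (S n) b /\ R n a b) ->
  exists f, f 0%nat = a0 /\ forall n, P n (f n) /\ R n (f n) (f (S n)).
Proof.
move=> P0 HR.
pose g n a := epsilon (inhabits a) (fun b => P (S n) b /\ R n a b).
pose f := nat_rect (fun _ => A) a0 g.
have Pf : forall n, P n (f n).
  elim=> [//|n IH]. by case: (epsilon_spec (inhabits (f n)) _ (HR _ _ IH)).
exists f; split=> // n; split=> //.
by case: (epsilon_spec (inhabits (f n)) _ (HR _ _ (Pf n))).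
Qed.

Lemma half_pow_pos n : 0 < (/ 2) ^ n.
Proof. apply: pow_lt; lra. Qed.

Lemma half_pow_lt eps : eps > 0 -> exists n, (/ 2) ^ n < eps.
Proof.
move=> He. have [|N HN] := pow_lt_1_zero (/ 2) _ eps He; first by rewrite Rabs_pos_eq; lra.
exists N. move: (HN N (le_n _)). rewrite Rabs_pos_eq //. by apply/Rlt_le/half_pow_pos.
Qed.

Lemma half_pow_le m n : (m <= n)%nat -> (/ 2) ^ n <= (/ 2) ^ m.
Proof.
elim=> [|k _ IH]; first lra.
move: (half_pow_pos k) => /= ?; lra.
Qed.

Section Metric.
Context {X : Polish}.
Implicit Types x y z : X.

Lemma dist_ge0 x y : 0 <= dist x y.
Proof. by case: (dist_metric X). Qed.
Lemma dist_xx x : dist x x = 0.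
Proof. by case: (dist_metric X). Qed.
Lemma dist_sep x y : dist x y = 0 -> x = y.
Proof. case: (dist_metric X) => *; auto. Qed.
Lemma dist_sym x y : dist x y = dist y x.
Proof. by case: (dist_metric X). Qed.
Lemma dist_tri y x z : dist x z <= dist x y + dist y z.
Proof. by case: (dist_metric X). Qed.

Lemma dist_small x y : (forall eps, eps > 0 -> dist x y < eps) -> x = y.
Proof.
move=> H; apply: dist_sep; have := dist_ge0 x y.
case: (Rle_lt_dec (dist x y) 0) => [|H1 _]; first lra.
move: (H _ H1); lra.
Qed.

Lemma nested_limit (u : nat -> X) (r : nat -> R) :
  (forall eps, eps > 0 -> exists n, r n < eps) ->
  (forall n m, (n <= m)%nat -> dist (u n) (u m) <= r n) ->
  exists l, forall n, dist (u n) l <= r n.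
Proof.
move=> Hr Hu.
have Hc : cauchy dist u.
  move=> eps He; have [|N HN] := Hr (eps / 2); first lra.
  exists N => n m Hn Hm; have := dist_tri (u N) (u n) (u m).
  rewrite (dist_sym (u n) (u N)); move: (Hu _ _ Hn) (Hu _ _ Hm); lra.
have [l Hl] := dist_complete X u Hc.
exists l => n; apply: Rle_trans (_ : r n + 0 <= _); last lra.
apply: le_epsilon => eps He; have [N HN] := Hl eps He.
have := dist_tri (u (max n N)) (u n) l.
move: (HN (max n N) (Nat.le_max_r _ _)) (Hu n (max n N) (Nat.le_max_l _ _)); lra.
Qed.

Lemma ball_open x r : is_open (fun y => dist x y < r).
Proof.
move=> y Hy; exists (r - dist x y); split; first lra.
move=> z Hz; have := dist_tri y x z; lra.
Qed.

Lemma open_ext (U V : X -> Prop) : (forall x, U x <-> V x) -> is_open U -> is_open V.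
Proof.
move=> H HU x /H /HU [e [He Hx]]; exists e; split=> // y /Hx; by apply H.
Qed.

Lemma open_and (U V : X -> Prop) : is_open U -> is_open V -> is_open (fun x => U x /\ V x).
Proof.
move=> HU HV x [/HU [e [He Hx]] /HV [e' [He' Hx']]].
exists (Rmin e e'); split; first by apply: Rmin_glb_lt.
move=> y Hy; split; [apply: Hx|apply: Hx'].
- by apply: Rlt_le_trans Hy (Rmin_l _ _).
- by apply: Rlt_le_trans Hy (Rmin_r _ _).
Qed.

Lemma open_or (U V : X -> Prop) : is_open U -> is_open V -> is_open (fun x => U x \/ V x).
Proof.
move=> HU HV x [/HU|/HV] [e [He Hx]]; exists e; split=> // y /Hx; by [left|right].
Qed.

End Metric.

(** * Baire category *)

Section Baire.
Context {X : Polish}.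

(** Closed balls, each inside the previous one and inside the next [E i], shrink to a point. Density
    is asked only inside [V], since sets pulled back along a partial map will be dense only
    there. *)
Lemma baire_category (V : X -> Prop) (E : nat -> X -> Prop) x0 :
  is_open V -> V x0 -> (forall i, is_open (E i)) ->
  (forall i (W : X -> Prop) x, is_open W -> (forall y, W y -> V y) -> W x ->
     exists y, W y /\ E i y) ->
  exists x, V x /\ forall i, E i x.
Proof.
move=> HV Vx0 HE HD.
have [e0 [He0 Hx0]] := HV _ Vx0.
pose P n (p : X * R) := 0 < p.2 <= (/ 2) ^ n /\ forall y, dist p.1 y <= p.2 -> V y.
pose R n (p q : X * R) :=
  forall y, dist q.1 y <= q.2 -> dist p.1 y <= p.2 /\ E n y.
have P0 : P 0%nat (x0, Rmin 1 (e0 / 2)).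
  split=> /=.
    split; [apply: Rmin_glb_lt; lra|exact: Rmin_l].
  move=> y Hy; apply: Hx0; move: (Rmin_r 1 (e0 / 2)); lra.
have step n p : P n p -> exists q, P (S n) q /\ R n p q.
  move=> [[Hr Hr2] HpV].
  have [|||y [Hy Ey]] := HD n (fun y => dist p.1 y < p.2) p.1.
  - exact: ball_open.
  - move=> y Hy; apply: HpV; lra.
  - by rewrite dist_xx.
  have [e [He Hy2]] : exists e, e > 0 /\
      forall z, dist y z < e -> dist p.1 z < p.2 /\ E n z.
    exact: (open_and _ _ (ball_open p.1 p.2) (HE n)).
  have rpos : 0 < Rmin (e / 2) ((/ 2) ^ S n).
    apply: Rmin_glb_lt; [lra|exact: half_pow_pos].
  have sub z : dist y z <= Rmin (e / 2) ((/ 2) ^ S n) -> dist p.1 z < p.2 /\ E n z.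
    move=> Hz; apply: Hy2; move: (Rmin_l (e / 2) ((/ 2) ^ S n)); lra.
  exists (y, Rmin (e / 2) ((/ 2) ^ S n)); split; [split=> /=|].
  - split=> //; exact: Rmin_r.
  - move=> z /sub [Hz _]; apply: HpV; lra.
  - move=> z /sub [Hz ?]; split=> //; lra.
have [f [_ Hf]] := dep_choice P R _ P0 step.
have mono n m : (n <= m)%nat -> forall y, dist (f m).1 y <= (f m).2 -> dist (f n).1 y <= (f n).2.
  elim=> [//|k _ IH] y Hy; apply: IH.
  by case: (Hf k) => _ /(_ _ Hy) [].
have [||l Hl] := nested_limit (fun n => (f n).1) (fun n => (f n).2).
- move=> eps /half_pow_lt [n Hn]; exists n; case: (Hf n) => [[[_ H] _] _]; lra.
- move=> n m Hnm; apply: (mono _ _ Hnm); rewrite dist_xx.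
  case: (Hf m) => [[[H _] _] _]; lra.
exists l; split.
- case: (Hf 0%nat) => [[_ H] _]; exact: H.
- by move=> i; case: (Hf i) => _ /(_ _ (Hl (S i))) [].
Qed.

(** * Comeager sets and the Baire property *)

Definition dense_open (D : X -> Prop) :=
  is_open D /\ forall W x, is_open W -> W x -> exists y, W y /\ D y.

Definition comeager (P : X -> Prop) :=
  exists D : nat -> X -> Prop, (forall i, dense_open (D i)) /\
    forall x, (forall i, D i x) -> P x.

Lemma comeager_sub (P Q : X -> Prop) : (forall x, P x -> Q x) -> comeager P -> comeager Q.
Proof. move=> H [D [HD HP]]; exists D; split=> // x /HP /H //. Qed.

Lemma comeager_all (P : nat -> X -> Prop) :
  (forall n, comeager (P n)) -> comeager (fun x => forall n, P n x).
Proof.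
move=> /choice_fun [D HD].
exists (fun k => D (fst (Cantor.of_nat k)) (snd (Cantor.of_nat k))); split.
- move=> k; by case: (HD (fst (Cantor.of_nat k))).
- move=> x Hx n; case: (HD n) => _; apply=> i.
  by move: (Hx (Cantor.to_nat (n, i))); rewrite Cantor.cancel_of_to.
Qed.

Lemma comeager_and (P Q : X -> Prop) :
  comeager P -> comeager Q -> comeager (fun x => P x /\ Q x).
Proof.
move=> HP HQ.
apply: (comeager_sub (fun x => forall n, (match n with O => P | _ => Q end) x)).
- by move=> x H; split; [exact: (H O)|exact: (H 1%nat)].
- by apply: comeager_all; case.
Qed.

Lemma comeager_dense_open D : dense_open D -> comeager D.
Proof. move=> HD; exists (fun _ => D); split=> // x H; exact: (H O). Qed.

Definition baire_property (A : X -> Prop) :=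
  exists U, is_open U /\ comeager (fun x => A x <-> U x).

(** If [U] approximates [A], then the exterior [V] of [U] approximates the complement, because the
    union of [U] and [V] is dense open. *)
Lemma borel_baire_property A : borel A -> baire_property A.
Proof.
elim=> {A} [U HU|A _ [U [HU HA]]|F _ IH|A A' HAA' _ [U [HU HA]]].
- exists U; split=> //; exists (fun _ _ => True); split=> //.
  by move=> _; split; [move=> x _; exists 1; split; [lra|]|move=> W x _ Wx; exists x].
- pose V x := exists e, e > 0 /\ forall y, dist x y < e -> ~ U y.
  have HV : is_open V.
    move=> x [e [He Hx]]; exists (e / 2); split; first lra.
    move=> y Hy; exists (e / 2); split; first lra.
    move=> z Hz; apply: Hx; have := dist_tri y x z; lra.
  exists V; split=> //.
  have HUV : comeager (fun x => U x \/ V x).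
    apply: comeager_dense_open; split; first exact: open_or.
    move=> W x HW Wx; case: (classic (exists y, W y /\ U y)) => [[y [Wy Uy]]|Hn].
      by exists y; split=> //; left.
    have [e [He Hx]] := HW _ Wx.
    exists x; split=> //; right; exists e; split=> // y /Hx Wy Uy; apply: Hn; by exists y.
  apply: (comeager_sub _ _ _ (comeager_and _ _ HA HUV)) => x [H1 H2]; split.
    by move=> nA; case: H2 => // /H1.
  move=> [e [He Hx]] /H1; apply: Hx; by rewrite dist_xx.
- move: IH => /choice_fun [U HU].
  exists (fun x => exists n, U n x); split.
    move=> x [n Un]; have [e [He Hx]] := proj1 (HU n) _ Un.
    exists e; split=> // y /Hx; by exists n.
  have H : comeager (fun x => forall n, F n x <-> U n x).
    by apply: comeager_all => n; case: (HU n).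
  apply: comeager_sub H => x H; split=> [] [n Hn]; exists n; by apply/H.
- exists U; split=> //; apply: comeager_sub HA => x; by rewrite HAA'.
Qed.

End Baire.

Lemma borel_preimage {X Y : Polish} (h : X -> Y) (A : Y -> Prop) :
  continuous h -> borel A -> borel (fun x => A (h x)).
Proof.
move=> Hh; elim=> {A} [U HU|A _ HA|F _ HF|A A' HAA' _ HA].
- apply: borel_open => x Ux; have [e [He Hx]] := HU _ Ux.
  have [d [Hd Hd2]] := Hh x e He; exists d; split=> // y /Hd2 /Hx //.
- exact: borel_compl HA.
- exact: borel_union.
- apply: borel_ext HA => x; exact: HAA'.
Qed.

(** By the Baire property each colour class is almost open. Near a generic point some [f m] has an
    edge with both ends in the open set [U n] of that point's colour. As [f m] is continuous and
    open, a generic point near the start of that edge has a generic image, and both then have colour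
    [n]. *)
Lemma complex_situation_uncountable (X : Polish) (f : nat -> pmap X) (c : X -> nat) :
  complex_situation X f -> borel_map_nat c ->
  exists x y, Af f x y /\ c x = c y.
Proof.
move=> [[x0] [Hf Hcl]] Hc.
have /choice_fun [U HU] : forall n, baire_property (fun x => c x = n).
  by move=> n; apply/borel_baire_property/Hc.
have : comeager (fun x => forall n, c x = n <-> U n x).
  by apply: comeager_all => n; case: (HU n).
case=> D [HD HDU].
have [x [_ Hx]] : exists x : X, True /\ forall i, D i x.
  apply: (baire_category (fun _ => True) D x0) => //.
  - by move=> x _; exists 1; split; [lra|].
  - by move=> i; case: (HD i).
  - move=> i W x HW _; by case: (HD i) => _; apply.
move: (proj1 (HDU x Hx (c x)) erefl); move: (c x) => n Ux {Hx}.
have oU := proj1 (HU n).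
have [e [He HxU]] := oU _ Ux.
have [x1 [_ [[m [Hm <-]] [Hd1 Hd2]]]] := proj1 (Hcl x) e He.
have [oD [_ [cf opf]]] := Hf m.
have preopen W : is_open W -> is_open (fun x => pdom (f m) x /\ W (pfun (f m) x)).
  move=> HW y [Dy Wy]; have [e1 [He1 H1]] := oD _ Dy.
  have [e2 [He2 H2]] := HW _ Wy.
  have [d [Hd H3]] := cf y e2 Dy He2.
  exists (Rmin e1 d); split; first by apply: Rmin_glb_lt.
  move=> z Hz.
  have Dz : pdom (f m) z by apply: H1; move: (Rmin_l e1 d); lra.
  split=> //; apply: H2; apply: H3 => //; move: (Rmin_r e1 d); lra.
pose V x := U n x /\ pdom (f m) x /\ U n (pfun (f m) x).
have oV : is_open V by apply: open_and => //; exact: preopen.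
have [||i||y [[Uy [Dy Ufy]] HE]] :=
  baire_category V (fun i x => D i x /\ pdom (f m) x /\ D i (pfun (f m) x)) x1.
- exact: oV.
- by split; [apply: HxU|split=> //; apply: HxU].
- have [oDi _] := HD i; apply: open_and => //; exact: preopen.
- move=> i W y HW HWV Wy.
  have [oDi dDi] := HD i.
  have oW' : is_open (fun z => W z /\ D i z) by exact: open_and.
  have [y' Wy'] := dDi _ _ HW Wy.
  (* The pullback of [D i] is dense: the open image of [W] intersected with [D i] meets [D i]. *)
  have oI := opf _ oW'.
  have [||z [[t [[Wt Dt] <-]] Dz]] := dDi _ (pfun (f m) y') (oI _).
  - by move=> t [/HWV [_ []]].
  - by exists y'.
  exists t; split=> //; split=> //; split=> //. by case: (HWV _ Wt) => _ [].
exists y, (pfun (f m) y); split; first by exists m.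
have -> : c y = n by apply/(HDU y) => // i; case: (HE i).
by symmetry; apply/(HDU (pfun (f m) y)) => // i; case: (HE i) => _ [].
Qed.

Lemma not_countable_of_complex (Y : Polish) (B : Y -> Y -> Prop) (X : Polish)
  (f : nat -> pmap X) :
  complex_situation X f -> inj_c_le (Af f) B \/ inj_c_le (Af f) (inv_rel B) ->
  ~ countable_borel_chromatic B.
Proof.
move=> HX Hh [c [Hc HcB]].
have [h [Hh1 Hh2]] : exists h : X -> Y, continuous h /\
    forall x x', Af f x x' -> B (h x) (h x') \/ B (h x') (h x).
  case: Hh => [] [h [_ [Hc1 H]]]; exists h; split=> // x x' /H; by [left|right].
have [|x [y [Hxy E]]] := complex_situation_uncountable X f (fun x => c (h x)) HX.
  move=> n; exact: (borel_preimage h (fun y => c y = n)).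
by case: (Hh2 _ _ Hxy) => /HcB; rewrite E.
Qed.

(** * Analytic sets and Lusin separation *)

Definition agree {A : Type} (n : nat) (a b : nat -> A) := forall i, (i < n)%nat -> a i = b i.

Lemma agree_le {A : Type} m n (a b : nat -> A) : (m <= n)%nat -> agree n a b -> agree m a b.
Proof. move=> Hmn H i Hi; apply: H; lia. Qed.

Lemma agree_sym {A : Type} n (a b : nat -> A) : agree n a b -> agree n b a.
Proof. by move=> H i Hi; rewrite H. Qed.

Lemma agree_trans {A : Type} n (a b c : nat -> A) : agree n a b -> agree n b c -> agree n a c.
Proof. by move=> H H' i Hi; rewrite H // H'. Qed.

(** Points of the Baire space; analytic sets are handled as continuous images of closed sets of
    codes. *)
Definition code := nat -> nat.

Definition closed_code (F : code -> Prop) :=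
  forall a, (forall n, exists b, F b /\ agree n a b) -> F a.

Definition code_cont {Y : Polish} (F : code -> Prop) (g : code -> Y) :=
  forall a eps, F a -> eps > 0 ->
    exists n, forall b, F b -> agree n a b -> dist (g a) (g b) < eps.

Definition proj (i : nat) (a : code) : code := fun k => a (Cantor.to_nat (i, k)).

Definition join (b : nat -> code) : code :=
  fun m => b (fst (Cantor.of_nat m)) (snd (Cantor.of_nat m)).

Lemma proj_join i b : proj i (join b) = b i.
Proof. by apply: functional_extensionality => k; rewrite /proj /join Cantor.cancel_of_to. Qed.

Lemma agree_proj i n : exists m, forall a b, agree m a b -> agree n (proj i a) (proj i b).
Proof.
elim: n => [|n [m Hm]]; first by exists O => a b _ k Hk; lia.
exists (S (max m (Cantor.to_nat (i, n)))) => a b H k Hk.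
case: (Nat.eq_dec k n) => [->|Hkn]; first by apply: H; lia.
apply: (Hm a b); last lia.
by apply: agree_le H; lia.
Qed.

Lemma closed_code_proj i F : closed_code F -> closed_code (fun a => F (proj i a)).
Proof.
move=> HF a Ha; apply: HF => n; have [m Hm] := agree_proj i n.
have [b [Fb Hb]] := Ha m; exists (proj i b); split=> //; exact: Hm.
Qed.

Lemma closed_code_all {I : Type} (F : I -> code -> Prop) :
  (forall i, closed_code (F i)) -> closed_code (fun a => forall i, F i a).
Proof.
move=> HF a Ha i; apply: HF => n; have [b [Fb Hb]] := Ha n; by exists b.
Qed.

Lemma closed_code_and F F' :
  closed_code F -> closed_code F' -> closed_code (fun a => F a /\ F' a).
Proof.
move=> HF HF' a Ha; split; [apply: HF|apply: HF'] => n;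
  have [b [[Fb F'b] Hb]] := Ha n; by exists b.
Qed.

Section CodeCont.
Context {Y : Polish}.
Implicit Types (F : code -> Prop) (g : code -> Y).

Lemma code_cont_sub F F' g : (forall a, F' a -> F a) -> code_cont F g -> code_cont F' g.
Proof.
move=> H Hg a eps Fa He; have [n Hn] := Hg a eps (H _ Fa) He.
by exists n => b /H; apply: Hn.
Qed.

Lemma code_cont_proj i F g :
  code_cont F g -> code_cont (fun a => F (proj i a)) (fun a => g (proj i a)).
Proof.
move=> Hg a eps Fa He; have [n Hn] := Hg _ eps Fa He.
have [m Hm] := agree_proj i n; exists m => b Fb Hb; apply: Hn => //; exact: Hm.
Qed.

Lemma code_cont_const F (y : Y) : code_cont F (fun _ => y).
Proof. by move=> a eps _ He; exists O => b _ _; rewrite dist_xx. Qed.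

Lemma closed_code_dist F g g' r : closed_code F -> code_cont F g -> code_cont F g' ->
  closed_code (fun a => F a /\ dist (g a) (g' a) <= r).
Proof.
move=> HF Hg Hg' a Ha.
have Fa : F a by apply: HF => n; have [b [[Fb _] Hb]] := Ha n; exists b.
split=> //; apply: le_epsilon => eps He.
have [|n Hn] := Hg a (eps / 2) Fa; first lra.
have [|m Hm] := Hg' a (eps / 2) Fa; first lra.
have [b [[Fb Hr] Hb]] := Ha (max n m).
have := dist_tri (g b) (g a) (g' a); have := dist_tri (g' b) (g b) (g' a).
have := Hn b Fb (agree_le _ _ _ _ (Nat.le_max_l _ _) Hb).
have := Hm b Fb (agree_le _ _ _ _ (Nat.le_max_r _ _) Hb).
rewrite (dist_sym (g' b) (g' a)); lra.
Qed.

Lemma closed_code_eq F g g' : closed_code F -> code_cont F g -> code_cont F g' ->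
  closed_code (fun a => F a /\ g a = g' a).
Proof.
move=> HF Hg Hg'; have H := closed_code_dist F g g' 0 HF Hg Hg'.
move=> a Ha; have [|Fa H0] := H a.
  move=> n; have [b [[Fb E] Hb]] := Ha n; exists b; split=> //; split=> //.
  rewrite E dist_xx; lra.
split=> //; apply: dist_sep; have := dist_ge0 (g a) (g' a); lra.
Qed.

End CodeCont.

Lemma code_cont_comp {Y Z : Polish} F (g : code -> Z) (f : Z -> Y) :
  code_cont F g -> continuous f -> code_cont F (fun a => f (g a)).
Proof.
move=> Hg Hf a eps Fa He; have [d [Hd H]] := Hf (g a) eps He.
have [n Hn] := Hg a d Fa Hd; exists n => b Fb Hb; exact: H (Hn b Fb Hb).
Qed.

(** A code of [y] names, for each [k], a point of the dense sequence at distance at most [(/ 2) ^ k]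
    from [y]. The non-strict bound survives limits, so by completeness the valid codes form a closed
    set. *)
Lemma polish_code {Y : Polish} (y0 : Y) : exists F (g : code -> Y),
  closed_code F /\ code_cont F g /\ forall y, exists a, F a /\ g a = y.
Proof.
have [s Hs] := dist_separable Y.
pose Q (a : code) (y : Y) :=
  forall k, exists p, s (a k) = Some p /\ dist y p <= (/ 2) ^ k.
have Qdist n a b y z : agree (S n) a b -> Q a y -> Q b z -> dist y z <= 2 * (/ 2) ^ n.
  move=> Hab Qa Qb; have [p [E Hp]] := Qa n; have [q [E' Hq]] := Qb n.
  move: E' E; rewrite -(Hab n (le_n _)) => -> [Epq]; subst q.
  have := dist_tri p y z; rewrite (dist_sym p z); lra.
have Hsmall eps : eps > 0 -> exists n, 2 * (/ 2) ^ n < eps.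
  move=> He; have [|n Hn] := half_pow_lt (eps / 2); first lra.
  exists n; lra.
pose g a := epsilon (inhabits y0) (Q a).
have gP a : (exists y, Q a y) -> Q a (g a) by exact: epsilon_spec.
exists (fun a => exists y, Q a y), g; split; [|split].
- move=> a /choice_fun [b Hb].
  have /choice_fun [y Hy] : forall n, exists y, Q (b n) y by move=> n; case: (Hb n).
  have [||l Hl] := nested_limit (fun n => y (S n)) (fun n => 2 * (/ 2) ^ n) => //.
  + move=> n m Hnm; apply: (Qdist _ (b (S n)) (b (S m))) => //.
    apply: agree_trans (agree_le _ (S m) a _ _ (proj2 (Hb (S m)))); last lia.
    exact: agree_sym (proj2 (Hb (S n))).
  + exists l => k.
    have Hpk n : (k < n)%nat -> exists p, s (a k) = Some p /\ dist (y n) p <= (/ 2) ^ k.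
      by move=> Hn; have [p] := Hy n k; rewrite -(proj2 (Hb n) k Hn); exists p.
    have [p [E _]] := Hpk (S k) (le_n _).
    exists p; split=> //; apply: le_epsilon => eps He.
    have [n Hn] := Hsmall eps He.
    have [|p' [E' Hp']] := Hpk (S (max n k)); first lia.
    move: E'; rewrite E => - [Epp]; subst p'.
    have := dist_tri (y (S (max n k))) l p; have := Hl (max n k).
    have := half_pow_le n (max n k) (Nat.le_max_l _ _).
    rewrite (dist_sym l (y (S (max n k)))); lra.
- move=> a eps Fa He; have [n Hn] := Hsmall eps He.
  exists (S n) => b Fb Hab; have := Qdist n a b _ _ Hab (gP _ Fa) (gP _ Fb); lra.
- move=> y.
  have /choice_fun [a Ha] : forall k, exists n, exists p, s n = Some p /\ dist y p <= (/ 2) ^ k.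
    move=> k; have [n [p [E Hp]]] := Hs y _ (half_pow_pos k).
    by exists n, p; split=> //; lra.
  have Fa : exists y, Q a y by exists y.
  exists a; split=> //; apply: dist_small => eps He; have [n Hn] := Hsmall eps He.
  have := Qdist n a a (g a) y (fun _ _ => erefl) (gP _ Fa) Ha; lra.
Qed.

(** * Closure properties of analytic sets *)

Definition analytic {Y : Polish} (A : Y -> Prop) := exists F (g : code -> Y),
  closed_code F /\ code_cont F g /\ forall y, A y <-> exists a, F a /\ g a = y.

Section Analytic.
Context {Y : Polish} (y0 : Y).
Implicit Types A C : Y -> Prop.

Lemma analytic_ext A A' : (forall y, A y <-> A' y) -> analytic A -> analytic A'.
Proof.
by move=> H [F [g [HF [Hg HA]]]]; exists F, g; split=> //; split=> // y; rewrite -H.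
Qed.

Lemma analytic_closed C : is_open (fun y => ~ C y) -> analytic C.
Proof using y0.
move=> HC; have [F [g [HF [Hg Hs]]]] := polish_code y0.
exists (fun a => F a /\ C (g a)), g; split; [|split].
- move=> a Ha.
  have Fa : F a by apply: HF => n; have [b [[Fb _] Hb]] := Ha n; exists b.
  split=> //; apply: NNPP => /HC [e [He H]].
  have [n Hn] := Hg a e Fa He; have [b [[Fb Cb] Hb]] := Ha n.
  by apply: H (Hn b Fb Hb) Cb.
- by apply: code_cont_sub Hg => a [].
- move=> y; split=> [Cy|[a [[_ Ca] <-]] //].
  by have [a [Fa E]] := Hs y; exists a; rewrite E.
Qed.

Lemma analytic_union (A : nat -> Y -> Prop) :
  (forall n, analytic (A n)) -> analytic (fun y => exists n, A n y).
Proof.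
move=> /choice_fun [F /choice_fun [g H]].
(* One digit of the code stores the index of the set. The index is thus locally constant, and
   closedness and continuity reduce to a fixed index. *)
pose idx a := proj 0 a 0%nat.
have Hidx a b : agree (S (Cantor.to_nat (0, 0)%nat)) a b -> idx a = idx b.
  by move=> Hab; apply: Hab; lia.
exists (fun a => F (idx a) (proj 1 a)), (fun a => g (idx a) (proj 1 a)); split; [|split].
- move=> a Ha; case: (H (idx a)) => HF _.
  apply: HF => n; have [m Hm] := agree_proj 1 n.
  have [b [Fb Hb]] := Ha (S (Cantor.to_nat (0, 0)%nat) + m)%nat.
  exists (proj 1 b); split.
    by rewrite (Hidx a b) //; apply: agree_le Hb; lia.
  by apply: Hm; apply: agree_le Hb; lia.
- move=> a eps Fa He; have [_ [Hg _]] := H (idx a).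
  have [n Hn] := Hg _ eps Fa He; have [m Hm] := agree_proj 1 n.
  exists (S (Cantor.to_nat (0, 0)%nat) + m)%nat => b Fb Hab.
  have E : idx a = idx b by apply: Hidx; apply: agree_le Hab; lia.
  rewrite -E in Fb *; apply: Hn => //; apply: Hm; apply: agree_le Hab; lia.
- move=> y; split=> [[n Any]|[a [Fa E]]].
    have [_ [_ HA]] := H n; have [a [Fa E]] := proj1 (HA y) Any.
    exists (join (fun i => match i with O => fun _ => n | _ => a end)).
    by rewrite /idx !proj_join.
  exists (idx a); have [_ [_ HA]] := H (idx a); apply/HA; by exists (proj 1 a).
Qed.

(** A code is a sequence of codes, one for each set, subject to the closed condition that all have
    the same value. *)
Lemma analytic_inter (A : nat -> Y -> Prop) :
  (forall n, analytic (A n)) -> analytic (fun y => forall n, A n y).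
Proof.
move=> /choice_fun [F /choice_fun [g H]].
pose G n a := F n (proj n a) /\ F O (proj O a).
have HG n : closed_code (G n).
  apply: closed_code_and; apply: closed_code_proj.
    by case: (H n).
  by case: (H O).
have cg n : code_cont (G n) (fun a => g n (proj n a)).
  apply: (code_cont_sub (fun a => F n (proj n a))); first by move=> a [].
  by apply: code_cont_proj; case: (H n) => _ [].
have c0 n : code_cont (G n) (fun a => g O (proj O a)).
  apply: (code_cont_sub (fun a => F O (proj O a))); first by move=> a [].
  by apply: code_cont_proj; case: (H O) => _ [].
exists (fun a => forall n, G n a /\ g n (proj n a) = g O (proj O a)), (fun a => g O (proj O a)).
split; [|split].
- apply: closed_code_all => n; exact: (closed_code_eq _ _ _ (HG n) (cg n) (c0 n)).
- by apply: (code_cont_sub _ _ _ _ (c0 O)) => a /(_ O) [].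
- move=> y; split=> [Ay|[a [Fa <-]] n].
    have /choice_fun [a Ha] : forall n, exists a, F n a /\ g n a = y.
      by move=> n; apply/(proj2 (proj2 (H n))).
    exists (join a); split=> [n|]; rewrite /G !proj_join.
      have [Fn En] := Ha n; have [F0 E0] := Ha O; by rewrite En E0.
    by case: (Ha O).
  have [[Fn _] E] := Fa n; apply/(proj2 (proj2 (H n))); by exists (proj n a).
Qed.

Lemma analytic_open (U : Y -> Prop) : is_open U -> analytic U.
Proof using y0.
move=> HU.
apply: (analytic_ext (fun y => exists n, forall z, dist y z < (/ 2) ^ n -> U z)).
  move=> y; split=> [[n H]|/HU [e [He H]]].
    by apply: H; rewrite dist_xx; exact: half_pow_pos.
  by have [n Hn] := half_pow_lt e He; exists n => z Hz; apply: H; lra.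
apply: analytic_union => n; apply: analytic_closed => y Hy.
have [z Hz0] := not_all_ex_not _ _ Hy.
have [Hz nUz] := imply_to_and _ _ Hz0.
exists ((/ 2) ^ n - dist y z); split; first lra.
move=> y' Hy' H; apply: nUz; apply: H.
have := dist_tri y y' z; rewrite (dist_sym y' y); lra.
Qed.

Lemma borel_analytic A : borel A -> analytic A /\ analytic (fun y => ~ A y).
Proof using y0.
elim=> {A} [U HU|A _ [HA HA']|F _ IH|A A' HAA' _ [HA HA']].
- split; first exact: analytic_open.
  apply: analytic_closed; apply: open_ext HU => y; split=> [? |]; [tauto|exact: NNPP].
- split=> //; apply: analytic_ext HA => y; split=> [? |]; [tauto|exact: NNPP].
- split; first by apply: analytic_union => n; case: (IH n).
  apply: (analytic_ext (fun y => forall n, ~ F n y)).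
    by move=> y; split=> [H [n]|H n Fn]; [exact: H|apply: H; exists n].
  by apply: analytic_inter => n; case: (IH n).
- split; [apply: analytic_ext HA|apply: analytic_ext HA'] => y; by rewrite HAA'.
Qed.

(** * Borel separation and Borel independent supersets *)

Definition separated (P Q : Y -> Prop) :=
  exists C, borel C /\ (forall y, P y -> C y) /\ (forall y, Q y -> ~ C y).

Lemma borel_inter (F : nat -> Y -> Prop) :
  (forall n, borel (F n)) -> borel (fun y => forall n, F n y).
Proof.
move=> HF; apply: (borel_ext (fun y => ~ exists n, ~ F n y)).
  move=> y; split=> [H n|H [n Hn]]; last exact: Hn.
  by apply: NNPP => Hn; apply: H; exists n.
apply: borel_compl; apply: borel_union => n; exact: borel_compl.
Qed.

Lemma separated_union (P Q : nat -> Y -> Prop) :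
  (forall i j, separated (P i) (Q j)) ->
  separated (fun y => exists i, P i y) (fun y => exists j, Q j y).
Proof.
move=> H; have /choice_fun [C HC] : forall i, exists C : nat -> Y -> Prop, forall j,
    borel (C j) /\ (forall y, P i y -> C j y) /\ (forall y, Q j y -> ~ C j y).
  by move=> i; exact: (choice_fun _ (H i)).
exists (fun y => exists i, forall j, C i j y); split; [|split].
- apply: borel_union => i; apply: borel_inter => j; by case: (HC i j).
- move=> y [i Pi]; exists i => j; case: (HC i j) => _ [H1 _]; exact: H1.
- move=> y [j Qj] [i Hi]; case: (HC i j) => _ [_ H1]; exact: H1 (Hi j).
Qed.

Lemma separated_sub (P P' Q Q' : Y -> Prop) :
  (forall y, P' y -> P y) -> (forall y, Q' y -> Q y) -> separated P Q -> separated P' Q'.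
Proof. move=> HP HQ [C [HC [H1 H2]]]; exists C; split=> //; split=> y; auto. Qed.

(** If separation failed, [separated_union] would let the prefixes of two codes be prolonged forever
    without the corresponding pieces becoming separable. The limit codes are valid and have distinct
    values, and a ball around one value separates the pieces of long enough prefixes. *)
Lemma lusin_separation A A' : analytic A -> analytic A' ->
  (forall y, A y -> A' y -> False) -> separated A A'.
Proof.
move=> [F [g [HF [Hg HA]]]] [F' [g' [HF' [Hg' HA']]]] Hdis.
pose piece (G : code -> Prop) (h : code -> Y) (u : code) n y :=
  exists a, G a /\ agree n u a /\ h a = y.
pose upd (u : code) n i : code := fun k => match Nat.eq_dec k n with left _ => i | right _ => u k end.
have agree_upd u n i : agree n u (upd u n i).
  by move=> k Hk; rewrite /upd; case: Nat.eq_dec => // E; lia.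
have piece_split G h u n y : piece G h u n y -> exists i, piece G h (upd u n i) (S n) y.
  move=> [a [Ga [Hu E]]]; exists (a n), a; split=> //; split=> // k Hk.
  by rewrite /upd; case: Nat.eq_dec => [->//|Hkn]; apply: Hu; lia.
apply: NNPP => Hn.
pose nosep n (p : code * code) := ~ separated (piece F g p.1 n) (piece F' g' p.2 n).
have [||f [_ Hf]] := dep_choice nosep (fun n p q => agree n p.1 q.1 /\ agree n p.2 q.2)
    (fun _ => O, fun _ => O).
- move=> Hs; apply: Hn; apply: separated_sub Hs => y.
    by case/HA => a [Fa E]; exists a; split=> //; split=> // k Hk; lia.
  by case/HA' => a [Fa E]; exists a; split=> //; split=> // k Hk; lia.
- move=> n [u v] /= Hs; apply: NNPP => H; apply: Hs.
  apply: (separated_sub _ _ _ _ (piece_split F g u n) (piece_split F' g' v n)).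
  apply: separated_union => i j; apply: NNPP => Hs; apply: H.
  by exists (upd u n i, upd v n j); split=> //; split; exact: agree_upd.
have lim (p : code * code -> code) : (forall n, agree n (p (f n)) (p (f (S n)))) ->
    forall n, agree n (p (f n)) (fun k => p (f (S k)) k).
  move=> Hp n k Hk; elim: n Hk => [|n IH] Hk; first lia.
  case: (Nat.eq_dec k n) => [->//|Hkn].
  by rewrite -(Hp n k) ?IH; lia.
have {}lim1 := lim fst (fun n => proj1 (proj2 (Hf n))).
have {lim}lim2 := lim snd (fun n => proj2 (proj2 (Hf n))).
move: lim1 lim2; set a := fun k => _; set b := fun k => _ => lim1 lim2.
have Hab n : ~ separated (piece F g a n) (piece F' g' b n).
  move=> Hs; case: (Hf n) => Hs' _; apply: Hs'.
  apply: separated_sub Hs => y [c [Gc [Hc E]]]; exists c; split=> //; split=> //.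
    apply: agree_trans Hc; exact/agree_sym/lim1.
  apply: agree_trans Hc; exact/agree_sym/lim2.
(* Otherwise, as [F] is closed, some piece along [a] would be empty and trivially separated. *)
have Fa : F a.
  apply: HF => n; apply: NNPP => H; apply: (Hab n).
  exists (fun _ => False); split; [|split] => //.
    by apply: borel_open => x [].
    by move=> y [c [Fc [Hc _]]]; apply: H; exists c.
  by move=> y _ [].
have Fb : F' b.
  apply: HF' => n; apply: NNPP => H; apply: (Hab n).
  exists (fun _ => True); split; [|split] => //.
    by apply: borel_open => x _; exists 1; split; [lra|].
  by move=> y [c [Fc [Hc _]]] _; apply: H; exists c.
have Hd : dist (g a) (g' b) > 0.
  case: (Rle_lt_dec (dist (g a) (g' b)) 0) => // H0.
  have E : g a = g' b by apply: dist_sep; have := dist_ge0 (g a) (g' b); lra.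
  by case: (Hdis (g a)); [apply/HA; exists a|apply/HA'; exists b].
have [|n Hn1] := Hg a (dist (g a) (g' b) / 2) Fa; first lra.
have [|m Hm1] := Hg' b (dist (g a) (g' b) / 2) Fb; first lra.
apply: (Hab (max n m)); exists (fun y => dist (g a) y < dist (g a) (g' b) / 2).
split; [|split].
- by apply: borel_open; apply: ball_open.
- move=> y [c [Fc [Hc <-]]]; apply: Hn1 => //; apply: agree_le Hc; lia.
- move=> y [c [Fc [Hc <-]]].
  have := Hm1 c Fc (agree_le _ _ _ _ (Nat.le_max_r _ _) Hc).
  have := dist_tri (g' c) (g a) (g' b); rewrite (dist_sym (g' c)); lra.
Qed.

(** Applied to the two coordinate maps of an analytic digraph, in either order, this gives the
    successors and the predecessors of a set. *)
Lemma analytic_image {Z : Polish} (z0 : Z) (f1 f2 : Z -> Y) A :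
  continuous f1 -> continuous f2 -> analytic A ->
  analytic (fun y => exists z, A (f1 z) /\ f2 z = y).
Proof.
move=> cf1 cf2 [F [g [HF [Hg HA]]]].
have [FZ [gZ [HFZ [HgZ Hs]]]] := polish_code z0.
pose G a := F (proj 0 a) /\ FZ (proj 1 a).
have HG : closed_code G by apply: closed_code_and; apply: closed_code_proj.
have cZ : code_cont G (fun a => gZ (proj 1 a)).
  by apply: (code_cont_sub _ _ _ _ (code_cont_proj 1 _ _ HgZ)) => a [].
have cF : code_cont G (fun a => g (proj 0 a)).
  by apply: (code_cont_sub _ _ _ _ (code_cont_proj 0 _ _ Hg)) => a [].
exists (fun a => G a /\ f1 (gZ (proj 1 a)) = g (proj 0 a)), (fun a => f2 (gZ (proj 1 a))).
split; [|split].
- apply: closed_code_eq => //; exact: code_cont_comp.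
- apply: (code_cont_sub _ _ _ _ (code_cont_comp _ _ f2 cZ cf2)) => a []; done.
- move=> y; split=> [[z [/HA [a [Fa E]] <-]]|[a [[[Fa FZa] E] <-]]].
    have [b [Fb Eb]] := Hs z.
    exists (join (fun i => match i with O => a | _ => b end)).
    by rewrite /G !proj_join Eb E.
  exists (gZ (proj 1 a)); split=> //; rewrite E; apply/HA; by exists (proj 0 a).
Qed.

Definition independent (B : Y -> Y -> Prop) (A : Y -> Prop) :=
  forall x y, A x -> A y -> ~ B x y.

(** Separate twice: [C] contains [A] and misses the successors of [A], then [D] contains [A] and
    misses the predecessors of [C]. An edge inside both [C] and [D] would start at a predecessor of
    [C]. *)
Lemma analytic_independent (B : Y -> Y -> Prop) A :
  analytic_rel B -> analytic A -> independent B A ->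
  exists C, borel C /\ independent B C /\ forall y, A y -> C y.
Proof using y0.
move=> [Z [g1 [g2 [cg1 [cg2 HB]]]]] HA Hind.
case: (classic (inhabited Z)) => [[z0]|nZ]; last first.
  exists (fun _ => True); split; [|split] => //.
    by apply: borel_open => x _; exists 1; split; [lra|].
  by move=> x y _ _ /HB [z _]; apply: nZ.
have [C [HC [AC CN]]] := lusin_separation _ _ HA (analytic_image z0 g1 g2 A cg1 cg2 HA)
  (fun y Ay '(ex_intro _ z (conj Hz E)) =>
     Hind (g1 z) y Hz Ay (proj2 (HB _ _) (ex_intro _ z (conj erefl E)))).
have HCa := proj1 (borel_analytic _ HC).
have [|D [HD [AD DN]]] := lusin_separation _ _ HA (analytic_image z0 g2 g1 C cg2 cg1 HCa).
  move=> y Ay [z [Cz E]]; apply: (CN (g2 z)) => //.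
  by exists z; rewrite E.
exists (fun y => forall n : nat, (match n with O => C | _ => D end) y); split; [|split].
- by apply: borel_inter; case.
- move=> x y Hx Hy /HB [z [E1 E2]]; apply: (DN x) (Hx 1%nat).
  by exists z; rewrite E2; split=> //; exact: (Hy O).
- by move=> y Ay; case=> [|n]; auto.
Qed.

End Analytic.

(** * Fusion along the G0 graph *)

Definition word := list bool.

Definition scons (e : bool) (z : nat -> bool) : nat -> bool :=
  fun n => match n with O => e | S k => z k end.

(* Words are stored with their last digit first, so [w' ++ w] extends [w]. *)
Fixpoint ap (w : word) (z : nat -> bool) : nat -> bool :=
  match w with [] => z | e :: w' => ap w' (scons e z) end.

Fixpoint pre (x : nat -> bool) (n : nat) : word :=
  match n with O => [] | S k => x k :: pre x k end.

Definition shift (n : nat) (x : nat -> bool) : nat -> bool := fun k => x (n + k)%nat.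

Lemma pre_length x n : length (pre x n) = n.
Proof. by elim: n => //= n ->. Qed.

Lemma ap_app w' w z : ap (w' ++ w) z = ap w (ap w' z).
Proof. by elim: w' z => //= e w' IH z; rewrite IH. Qed.

Lemma pre_scons e z n : pre (scons e z) (S n) = pre z n ++ [e].
Proof. by elim: n => //= n ->. Qed.

Lemma pre_ap w z k : pre (ap w z) (k + length w) = pre z k ++ w.
Proof.
elim: w z k => [|e w IH] z k /=; first by rewrite app_nil_r Nat.add_0_r.
rewrite -Nat.add_succ_comm IH pre_scons -app_assoc //.
Qed.

Lemma pre_ap0 w z : pre (ap w z) (length w) = w.
Proof. exact: (pre_ap w z 0). Qed.

Lemma shift_scons x n : shift n x = scons (x n) (shift (S n) x).
Proof.
apply: functional_extensionality => -[|k]; rewrite /shift /=; first by rewrite Nat.add_0_r.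
by rewrite Nat.add_succ_r.
Qed.

Lemma ap_pre_shift n x : ap (pre x n) (shift n x) = x.
Proof. by elim: n => //= n IH; rewrite -shift_scons. Qed.

Lemma pre_shift k n x : pre x (k + n) = pre (shift n x) k ++ pre x n.
Proof. by have := pre_ap (pre x n) (shift n x) k; rewrite pre_length ap_pre_shift. Qed.

Lemma agree_pre n (x y : nat -> bool) : agree n x y <-> pre x n = pre y n.
Proof.
elim: n => [|n [IH1 IH2]]; first by split=> // _ i Hi; lia.
split=> [H|/= [E1 /IH2 E2] i Hi].
  rewrite /= (H n); first lia.
  by rewrite IH1 //; apply: agree_le H; lia.
by case: (Nat.eq_dec i n) => [->|Hin] //; apply: E2; lia.
Qed.

Fixpoint all_words (n : nat) : list word :=
  match n with
  | O => [[]]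
  | S k => map (cons false) (all_words k) ++ map (cons true) (all_words k)
  end.

Lemma all_words_In w n : length w = n -> In w (all_words n).
Proof.
move=> <-; elim: w => [|e w IH] /=; first by left.
by apply: in_or_app; case: e; [right|left]; apply: in_map.
Qed.

(** Coordinate [0] of the code carries [b], coordinate [S i] a witness for [D i (h i b)]. In
    [double] the sets [D i] are complements of Borel independent sets deleted from a family of
    configurations. *)
Lemma analytic_image_code {Y : Polish} F (g : code -> Y) (h : nat -> code -> Y)
    (D : nat -> Y -> Prop) :
  closed_code F -> code_cont F g -> (forall i, code_cont F (h i)) ->
  (forall i, analytic (D i)) ->
  analytic (fun y => exists b, F b /\ g b = y /\ forall i, D i (h i b)).
Proof.
move=> HF Hg Hh /choice_fun [G /choice_fun [k HD]].
pose K i a := F (proj 0 a) /\ G i (proj (S i) a).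
have HK i : closed_code (K i).
  apply: closed_code_and; apply: closed_code_proj => //; by case: (HD i).
exists (fun a => F (proj 0 a) /\
   forall i, K i a /\ k i (proj (S i) a) = h i (proj 0 a)), (fun a => g (proj 0 a)).
split; [|split].
- apply: closed_code_and; first exact: closed_code_proj.
  apply: closed_code_all => i; apply: closed_code_eq => //.
    apply: (code_cont_sub (fun a => G i (proj (S i) a))); first by move=> a [].
    by apply: code_cont_proj; case: (HD i) => _ [].
  apply: (code_cont_sub (fun a => F (proj 0 a))); first by move=> a [].
  exact: code_cont_proj.
- apply: (code_cont_sub (fun a => F (proj 0 a))); first by move=> a [].
  exact: code_cont_proj.
- move=> y; split=> [[b [Fb [E Hb]]]|[a [[Fa Ha] E]]].
    have /choice_fun [c Hc] : forall i, exists c, G i c /\ k i c = h i b.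
      by move=> i; apply/(proj2 (proj2 (HD i))).
    exists (join (fun i => match i with O => b | S i => c i end)).
    rewrite /K !proj_join; split=> //; split=> // i; rewrite !proj_join.
    by case: (Hc i).
  exists (proj 0 a); split=> //; split=> // i; apply/(proj2 (proj2 (HD i))).
  by exists (proj (S i) a); case: (Ha i) => [[_ ?] ?].
Qed.

Lemma dense_seq {Y : Polish} (y0 : Y) :
  exists p : nat -> Y, forall y eps, eps > 0 -> exists i, dist y (p i) < eps.
Proof.
have [s Hs] := dist_separable Y.
exists (fun i => match s i with Some p => p | None => y0 end) => y eps /(Hs y) [i [p [E H]]].
by exists i; rewrite E.
Qed.

Lemma closed_code_const (P : Prop) : closed_code (fun _ => P).
Proof. by move=> a /(_ O) [b []]. Qed.

Definition cantor_cont {Y : Polish} (h : (nat -> bool) -> Y) := forall x eps, eps > 0 ->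
  exists n, forall x', agree n x x' -> dist (h x) (h x') < eps.

Definition twins {Y : Type} (h : (nat -> bool) -> Y) (s t : word) :=
  forall z, h (ap s z) = h (ap t z).

Definition dichotomous {Y : Type} (h : (nat -> bool) -> Y) := forall s t,
  length s = length t -> twins h s t \/ forall z z', h (ap s z) <> h (ap t z').

Definition linked {Y : Type} (h : (nat -> bool) -> Y) (B : Y -> Y -> Prop) (s t : word) :=
  forall z, B (h (ap s z)) (h (ap t z)).

(** * Large families of finite copies of the G0 graph *)

Section Fusion.
Context {Y Z : Polish} (y0 : Y) (z0 : Z) (B : Y -> Y -> Prop) (g1 g2 : Z -> Y).
Hypothesis cg1 : continuous g1.
Hypothesis cg2 : continuous g2.
Hypothesis HB : forall y y', B y y' <-> exists z, g1 z = y /\ g2 z = y'.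
Variable s : nat -> word.
Hypothesis s_length : forall n, length (s n) = n.

(** Under [wf l], each code in [dom] describes a copy in [B] of the finite graph on words of length
    [l]: [vert w] is the image of [w], and [edge n w] is a point of [Z] witnessing the edge from
    [w ++ false :: s n] to [w ++ true :: s n]. *)
Record config := {
  dom : code -> Prop;
  vert : word -> code -> Y;
  edge : nat -> word -> code -> Z }.

Definition wf l P :=
  closed_code (dom P) /\
  (forall w, length w = l -> code_cont (dom P) (vert P w)) /\
  (forall n w, (S n + length w)%nat = l -> code_cont (dom P) (edge P n w)) /\
  (forall n w a, (S n + length w)%nat = l -> dom P a ->
     g1 (edge P n w a) = vert P (w ++ false :: s n) a /\
     g2 (edge P n w a) = vert P (w ++ true :: s n) a).

(** The sigma-ideal that drives the fusion. At level [0], with all points of [Y] as values,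
    smallness means a cover by countably many Borel independent sets, hence a countable Borel
    colouring. *)
Definition small l (F : code -> Prop) (v : word -> code -> Y) :=
  exists (A : nat -> Y -> Prop) (u : nat -> word),
    (forall i, borel (A i) /\ independent B (A i) /\ length (u i) = l) /\
    forall a, F a -> exists i, A i (v (u i) a).

Lemma large_piece l F v (G : nat -> code -> Prop) :
  ~ small l F v -> (forall a, F a -> exists i, G i a) -> exists i, ~ small l (G i) v.
Proof.
move=> HF Hcov; apply: NNPP => Hn; apply: HF.
have /choice_fun [A /choice_fun [u H]] : forall i, small l (G i) v.
  by move=> i; apply: NNPP => Hi; apply: Hn; exists i.
exists (fun k => A (fst (Cantor.of_nat k)) (snd (Cantor.of_nat k))).
exists (fun k => u (fst (Cantor.of_nat k)) (snd (Cantor.of_nat k))).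
split=> [k|a /Hcov [i Gi]].
  by case: (H (fst (Cantor.of_nat k))).
have [j Hj] := proj2 (H i) a Gi.
by exists (Cantor.to_nat (i, j)); rewrite Cantor.cancel_of_to.
Qed.

Lemma large_inhabited l F v : ~ small l F v -> exists a, F a.
Proof.
move=> H; apply: NNPP => Hn; apply: H.
exists (fun _ _ => False), (fun _ => repeat false l); split=> [i|a Fa].
  split; [by apply: borel_open => y []|split; [by []|exact: repeat_length]].
by case: Hn; exists a.
Qed.

(** Finitely many requirements are met one after another; monotonicity preserves the earlier
    ones. *)
Lemma shrink_all {I : Type} l F v (T : I -> (code -> Prop) -> Prop) (L : list I) :
  (forall i G G', (forall a, G' a -> G a) -> T i G -> T i G') ->
  (forall i G, In i L -> closed_code G -> (forall a, G a -> F a) -> ~ small l G v ->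
     exists G', closed_code G' /\ (forall a, G' a -> G a) /\ ~ small l G' v /\ T i G') ->
  closed_code F -> ~ small l F v ->
  exists G, closed_code G /\ (forall a, G a -> F a) /\ ~ small l G v /\
    forall i, In i L -> T i G.
Proof.
move=> mono; elim: L => [|i L IH] Hstep HF HL; first by exists F; split=> //; split=> //.
have [|G [cG [GF [lG TG]]]] := IH _ HF HL.
  by move=> j G Hj; apply: Hstep; right.
have [|G' [cG' [G'G [lG' TG']]]] := Hstep i G _ cG GF lG; first by left.
exists G'; split; [done|split; [by auto|split; [done|]]].
move=> j [<-//|Hj]; exact: (mono _ _ _ G'G (TG j Hj)).
Qed.

(** The last clause decides each pair of words: values always equal, or ranges a positive distance
    apart. In the limit this becomes [dichotomous]. *)
Definition tight l (v : word -> code -> Y) (e : nat -> word -> code -> Z) (G : code -> Prop) :=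
  (forall w, length w = l -> forall a b, G a -> G b -> dist (v w a) (v w b) <= (/ 2) ^ l) /\
  (forall n w, (S n + length w)%nat = l ->
     forall a b, G a -> G b -> dist (e n w a) (e n w b) <= (/ 2) ^ l) /\
  (forall w w', length w = l -> length w' = l ->
     (forall a, G a -> v w a = v w' a) \/
     exists d, d > 0 /\ forall a b, G a -> G b -> d <= dist (v w a) (v w' b)).

Lemma shrink_diam {W : Polish} (w0 : W) l F v (g : code -> W) r :
  r > 0 -> closed_code F -> ~ small l F v -> code_cont F g ->
  exists G, closed_code G /\ (forall a, G a -> F a) /\ ~ small l G v /\
    forall a b, G a -> G b -> dist (g a) (g b) <= r.
Proof.
move=> Hr HF HL Hg; have [p Hp] := dense_seq w0.
have [|i Hi] := large_piece l F v (fun i a => F a /\ dist (g a) (p i) <= r / 2) HL.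
  move=> a Fa; have [|i Hi] := Hp (g a) (r / 2); first lra.
  exists i; split=> //; lra.
exists (fun a => F a /\ dist (g a) (p i) <= r / 2); split; [|split; [|split]] => //.
- apply: closed_code_dist => //; exact: code_cont_const.
- by move=> a [].
- move=> a b [_ Ha] [_ Hb]; have := dist_tri (p i) (g a) (g b).
  rewrite (dist_sym (p i)); lra.
Qed.

Lemma shrink_pair l F v (g g' : code -> Y) :
  closed_code F -> ~ small l F v -> code_cont F g -> code_cont F g' ->
  exists G, closed_code G /\ (forall a, G a -> F a) /\ ~ small l G v /\
    ((forall a, G a -> g a = g' a) \/
     exists d, d > 0 /\ forall a b, G a -> G b -> d <= dist (g a) (g' b)).
Proof using y0.
move=> HF HL Hg Hg'; have [p Hp] := dense_seq y0.
(* Balls of radius [(/ 2) ^ k] whose centres are at least three radii apart leave a gap of one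
   radius. *)
pose Sep i j k a := (F a /\ dist (g a) (p i) <= (/ 2) ^ k) /\
  (F a /\ dist (g' a) (p j) <= (/ 2) ^ k) /\ 3 * (/ 2) ^ k <= dist (p i) (p j).
pose piece n a := match n with
  | O => F a /\ g a = g' a
  | S n => let (ij, k) := Cantor.of_nat n in let (i, j) := Cantor.of_nat ij in Sep i j k a
  end.
have [|n Hn] := large_piece l F v piece HL.
  move=> a Fa; case: (classic (g a = g' a)) => [E|E]; first by exists O.
  have Hd : dist (g a) (g' a) > 0.
    case: (Rle_lt_dec (dist (g a) (g' a)) 0) => // H.
    case: E; apply: dist_sep; have := dist_ge0 (g a) (g' a); lra.
  (* The 5 pays for the three radii between the centres and two approximation errors. *)
  have [|k Hk] := half_pow_lt (dist (g a) (g' a) / 5); first lra.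
  have [i Hi] := Hp (g a) _ (half_pow_pos k).
  have [j Hj] := Hp (g' a) _ (half_pow_pos k).
  exists (S (Cantor.to_nat (Cantor.to_nat (i, j), k))).
  rewrite /piece !Cantor.cancel_of_to /Sep.
  have := dist_tri (p i) (g a) (g' a); have := dist_tri (p j) (p i) (g' a).
  rewrite (dist_sym (p j)); split; [split=> //; lra|split; [split=> //; lra|lra]].
exists (piece n); rewrite /piece in Hn *; case: n Hn => [|n] Hn.
  split; [exact: closed_code_eq|split; [by move=> a []|split=> //]].
  by left=> a [].
move: Hn; case: (Cantor.of_nat n) => ij k; case: (Cantor.of_nat ij) => i j Hn.
split; [|split; [by move=> a [[]]|split=> //]].
  apply: closed_code_and; first by apply: closed_code_dist => //; exact: code_cont_const.
  apply: closed_code_and; last exact: closed_code_const.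
  by apply: closed_code_dist => //; exact: code_cont_const.
right; exists ((/ 2) ^ k); split; first exact: half_pow_pos.
move=> a b [[_ Ha] [_ Hij]] [_ [[_ Hb] _]].
have := dist_tri (g a) (p i) (p j); have := dist_tri (g' b) (g a) (p j).
rewrite (dist_sym (p i) (g a)); lra.
Qed.

Lemma shrink_tight l P : wf l P -> ~ small l (dom P) (vert P) ->
  exists Q, wf l Q /\ ~ small l (dom Q) (vert Q) /\ tight l (vert Q) (edge Q) (dom Q) /\
    (forall a, dom Q a -> dom P a) /\ vert Q = vert P /\ edge Q = edge P.
Proof using y0 z0.
move=> [cP [vP [eP gP]]] lP.
pose nw := flat_map (fun n => map (pair n) (all_words (l - S n))) (seq 0 l).
have nw_In n w : (S n + length w)%nat = l -> In (n, w) nw.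
  move=> E; apply/in_flat_map; exists n; split; first by apply/in_seq; lia.
  by apply: in_map; apply: all_words_In; lia.
have [||G1 [c1 [s1 [l1 T1]]]] := shrink_all l (dom P) (vert P)
  (fun w G => length w = l -> forall a b, G a -> G b -> dist (vert P w a) (vert P w b) <= (/ 2) ^ l)
  (all_words l) _ _ cP lP.
- by move=> w G G' GG H E a b /GG Ga /GG Gb; exact: H.
- move=> w G _ cG sG lG; case: (Nat.eq_dec (length w) l) => E; last by exists G.
  have [|G' [? [? [? ?]]]] := shrink_diam y0 l G (vert P) (vert P w) _ (half_pow_pos l) cG lG.
    by exact: (code_cont_sub _ _ _ sG (vP w E)).
  by exists G'.
have [||G2 [c2 [s2 [l2 T2]]]] := shrink_all l G1 (vert P)
  (fun nw G => (S (fst nw) + length (snd nw))%nat = l -> forall a b, G a -> G b ->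
     dist (edge P (fst nw) (snd nw) a) (edge P (fst nw) (snd nw) b) <= (/ 2) ^ l)
  nw _ _ c1 l1.
- by move=> w G G' GG H E a b /GG Ga /GG Gb; exact: H.
- move=> [n w] G _ cG sG lG /=; case: (Nat.eq_dec (S n + length w) l) => E; last by exists G.
  have [|G' [? [? [? ?]]]] := shrink_diam z0 l G (vert P) (edge P n w) _ (half_pow_pos l) cG lG.
    by apply: (code_cont_sub (dom P)); [auto|exact: eP].
  by exists G'.
have [||G3 [c3 [s3 [l3 T3]]]] := shrink_all l G2 (vert P)
  (fun p G => length (fst p) = l -> length (snd p) = l ->
     (forall a, G a -> vert P (fst p) a = vert P (snd p) a) \/
     exists d, d > 0 /\ forall a b, G a -> G b -> d <= dist (vert P (fst p) a) (vert P (snd p) b))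
  (list_prod (all_words l) (all_words l)) _ _ c2 l2.
- move=> p G G' GG H E E'; case: (H E E') => [H1|[d [Hd H1]]]; [left|right].
    by move=> a /GG; exact: H1.
  by exists d; split=> // a b /GG Ga /GG Gb; exact: H1.
- move=> [w w'] G _ cG sG lG /=.
  case: (classic (length w = l /\ length w' = l)) => [[E E']|E]; last first.
    by exists G; split=> //; split=> //; split=> // E1 E2; case: E.
  have [||G' [? [? [? ?]]]] := shrink_pair l G (vert P) (vert P w) (vert P w') cG lG.
    by apply: (code_cont_sub (dom P)); [auto|exact: vP].
    by apply: (code_cont_sub (dom P)); [auto|exact: vP].
  by exists G'.
exists {| dom := G3; vert := vert P; edge := edge P |}.
have G3P a : G3 a -> dom P a by auto.
split; [split; [|split; [|split]]|split; [|split; [split; [|split]|]]] => //=.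
- move=> w E; exact: (code_cont_sub _ _ _ G3P (vP w E)).
- move=> n w E; exact: (code_cont_sub _ _ _ G3P (eP n w E)).
- by move=> n w a E /G3P; exact: gP.
- move=> w E a b Ga Gb; apply: T1 => //; auto; exact: all_words_In.
- move=> n w E a b Ga Gb; apply: (T2 (n, w)) => //; auto; exact: nw_In.
- move=> w w' E E'; apply: (T3 (w, w')) => //; apply: in_prod; exact: all_words_In.
Qed.

(** The last digit [e] of a word selects one of the two halves of a member of [Q]; that half must
    carry the values of a member of [P]. *)
Definition refines (P Q : config) := forall e a, dom Q a -> exists b, dom P b /\
  (forall w, vert Q (e :: w) a = vert P w b) /\
  (forall n w, edge Q n (e :: w) a = edge P n w b).

Definition side (e : bool) : nat := match e with true => 1%nat | false => 0%nat end.

(* Bernshteyn's argument: if the pairs of configurations joined by a new edge were covered by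
   countably many small sets, deleting the corresponding vertices from one configuration at
   a time would leave a large set whose projection to [s l] is independent. *)
Lemma double l P : wf l P -> ~ small l (dom P) (vert P) ->
  exists Q, wf (S l) Q /\ ~ small (S l) (dom Q) (vert Q) /\ refines P Q.
Proof using y0 z0 cg1 cg2 HB s_length.
move=> [cP [vP [eP gP]]] lP.
have [FZ [gZ [cZ [ctZ Hs]]]] := polish_code z0.
(* A code holds two members of [P] and the code of a point of [Z] witnessing the new edge between
   their vertices at [s l]. *)
pose D a := dom P (proj 0 a) /\ dom P (proj 1 a) /\ FZ (proj 2 a).
pose Q := {|
  dom := fun a => (D a /\ g1 (gZ (proj 2 a)) = vert P (s l) (proj 0 a)) /\
                  (D a /\ g2 (gZ (proj 2 a)) = vert P (s l) (proj 1 a));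
  vert := fun w a => match w with [] => y0 | e :: w' => vert P w' (proj (side e) a) end;
  edge := fun n w a => match w with [] => gZ (proj 2 a)
                       | e :: w' => edge P n w' (proj (side e) a) end |}.
have cD : closed_code D.
  apply: closed_code_and; first exact: closed_code_proj.
  by apply: closed_code_and; exact: closed_code_proj.
have pD e a : D a -> dom P (proj (side e) a) by case: e => [] [? []].
have contZ : code_cont D (fun a => gZ (proj 2 a)).
  apply: (code_cont_sub (fun a => FZ (proj 2 a))); first by move=> a [_ []].
  exact: code_cont_proj.
have contP (W : Polish) (g : code -> W) e : code_cont (dom P) g ->
    code_cont D (fun a => g (proj (side e) a)).
  move=> Hg; apply: (code_cont_sub (fun a => dom P (proj (side e) a))); first exact: pD.
  exact: code_cont_proj.
have QD a : dom Q a -> D a by case=> [[]].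
exists Q; split; [split; [|split; [|split]]|split].
- apply: closed_code_and; apply: closed_code_eq => //.
  + exact: code_cont_comp.
  + apply: (contP Y (vert P (s l)) false); exact: vP.
  + exact: code_cont_comp.
  + apply: (contP Y (vert P (s l)) true); exact: vP.
- case=> [//|e w] /= [E]; apply: code_cont_sub QD _; apply: (contP _ (vert P w)); exact: vP.
- move=> n [|e w] /= E; apply: code_cont_sub QD _ => //.
  apply: (contP _ (edge P n w)); apply: eP; lia.
- move=> n [|e w] a /= E Qa.
    have -> : n = l by lia.
    by case: Qa => [[_ ->] [_ ->]].
  apply: gP; first lia.
  exact/pD/QD.
- move=> [A [u [HA Hcov]]].
  pose u' i := tl (u i).
  have Hu i : exists e, u i = e :: u' i.
    rewrite /u'; have [_ [_]] := HA i; by case: (u i) => // e w; exists e.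
  have Hlu i : length (u' i) = l.
    have [_ [_]] := HA i; have [e ->] := Hu i; by case.
  have Ha : analytic (fun y => exists b, dom P b /\ vert P (s l) b = y /\
      forall i, ~ A i (vert P (u' i) b)).
    apply: (analytic_image_code _ _ (fun i => vert P (u' i)) (fun i y => ~ A i y)) => //.
    + exact: vP.
    + move=> i; exact: vP.
    + move=> i; exact: (proj2 (borel_analytic y0 (A i) (proj1 (HA i)))).
  apply: lP.
  have [||C [bC [iC HC]]] := analytic_independent y0 B _ _ Ha.
  + by exists Z, g1, g2.
  (* An edge between two remaining members would yield a member of [Q] avoiding every [A i] at
     [u i], against the assumed cover. *)
  + move=> x y [b [Pb [Eb Hb]]] [b' [Pb' [Eb' Hb']]] /HB [z [E1 E2]].
    have [c [FZc Ec]] := Hs z.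
    pose a := join (fun i => match i with O => b | 1%nat => b' | _ => c end).
    have [|i] := Hcov a.
      by rewrite /= /D /a !proj_join Ec E1 E2 Eb Eb'.
    have [e ->] := Hu i.
    by rewrite /= /a proj_join; case: e => /=; [exact: Hb'|exact: Hb].
  (* The set [C] at the vertex [s l], together with the deleted sets, covers [P], so [P] would be
     small. *)
  exists (fun i => match i with O => C | S i => A i end).
  exists (fun i => match i with O => s l | S i => u' i end).
  split=> [[|i]|b Pb]; first by split.
    by split; [|split]; case: (HA i) => // _ [].
  case: (classic (exists i, A i (vert P (u' i) b))) => [[i Hi]|Hn]; first by exists (S i).
  exists O; apply: HC; exists b; split=> //; split=> // i Ai; apply: Hn; by exists i.
- move=> e a Qa; exists (proj (side e) a); split=> //; exact/pD/QD.
Qed.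

Lemma refines_iter (P : nat -> config) : (forall l, refines (P l) (P (S l))) ->
  forall l w a, dom (P (length w + l)%nat) a -> exists b, dom (P l) b /\
    (forall t, vert (P (length w + l)%nat) (w ++ t) a = vert (P l) t b) /\
    (forall n t, edge (P (length w + l)%nat) n (w ++ t) a = edge (P l) n t b).
Proof.
move=> HP l; elim=> [|e w IH] a /=; first by exists a.
move=> /(HP _ e) [b [/IH [c [Pc [Vc Ec]]] [Vb Eb]]]; exists c; split=> //.
by split=> *; rewrite ?Vb ?Eb ?Vc ?Ec.
Qed.

Lemma fusion : ~ countable_borel_chromatic B ->
  exists h : (nat -> bool) -> Y, cantor_cont h /\ dichotomous h /\
    forall n, linked h B (false :: s n) (true :: s n).
Proof using y0 z0 cg1 cg2 HB s_length.
move=> Hn.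
pose good l P := wf l P /\ ~ small l (dom P) (vert P) /\ tight l (vert P) (edge P) (dom P).
have [P0 HP0] : exists P, good O P.
  have [FY [gY [cY [ctY Hs]]]] := polish_code y0.
  pose P := {| dom := FY; vert := fun _ => gY; edge := fun _ _ _ => z0 |}.
  have [||Q [? [? [? _]]]] := shrink_tight 0 P; last by exists Q.
  - by split=> //; split=> //; split.
  (* A countable cover by Borel independent sets yields a colouring: the least index of a set
     containing the point. *)
  - move=> [A [u [HA Hcov]]]; apply: Hn.
    have Hex y : exists i, A i y by have [a [Fa <-]] := Hs y; case: (Hcov a Fa) => i; exists i.
    have /choice_fun [c Hc] : forall y, exists i, A i y /\ forall j, (j < i)%nat -> ~ A j y.
      move=> y; have [i] := Hex y; elim/(well_founded_induction Wf_nat.lt_wf): i => i IH Ai.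
      case: (classic (exists j, (j < i)%nat /\ A j y)) => [[j [Hj Aj]]|Hj]; first exact: IH Hj Aj.
      by exists i; split=> // j Hji Aj; apply: Hj; exists j.
    exists c; split.
      move=> n; apply: (borel_ext (fun y => forall k, (match k with O => A n y
          | S j => ~ ((j < n)%nat /\ A j y) end))).
        move=> y; split=> [H|<- [|j] /=]; last 2 first.
        + by case: (Hc y).
        + by case=> Hj; case: (Hc y) => _ /(_ j Hj).
        case: (Hc y) => Acy Hlt.
        case: (Nat.lt_trichotomy (c y) n) => [Hl|[//|Hl]].
        + by case: (H (S (c y))).
        + by case: (Hlt n Hl (H O)).
      apply: borel_inter => -[|j]; first by case: (HA n).
      apply: borel_compl; case: (Nat.lt_ge_cases j n) => Hj.
        apply: (borel_ext (A j)); [by move=> y; split=> // -[]|by case: (HA j)].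
      by apply: borel_open => y [? _]; lia.
    move=> y y' Byy' E; have [_ [iA _]] := HA (c y); apply: (iA y y') Byy'.
      by case: (Hc y).
    by rewrite E; case: (Hc y').
have [|P [_ HP]] := dep_choice good (fun _ => refines) P0 HP0.
  move=> l P [wP [lP _]]; have [Q [wQ [lQ rQ]]] := double l P wP lP.
  have [Q' [wQ' [lQ' [tQ' [sub [EV EE]]]]]] := shrink_tight _ Q wQ lQ.
  exists Q'; split=> // e a /sub /(rQ e); by rewrite EV EE.
have ref := refines_iter P (fun l => proj2 (HP l)).
have /choice_fun [a Ha] : forall l, exists a, dom (P l) a.
  by move=> l; case: (HP l) => [[_ [/large_inhabited]]].
(* The members [a l] are chosen independently for each level. Still, a later one restricts to some
   member of [dom (P l)], so tightness makes [v l x] a Cauchy sequence in [l]. *)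
pose v l x := vert (P l) (pre x l) (a l).
have vstep l k x : exists b, dom (P l) b /\ v (k + l)%nat x = vert (P l) (pre x l) b.
  have := ref l (pre (shift l x) k); rewrite pre_length => /(_ _ (Ha _)) [b [Pb [Vb _]]].
  by exists b; split=> //; rewrite /v pre_shift Vb.
have Hlim x : exists y, forall l, dist (v l x) y <= (/ 2) ^ l.
  apply: nested_limit; first exact: half_pow_lt.
  move=> n m Hnm; have [b [Pb]] := vstep n (m - n)%nat x.
  have -> : (m - n + n = m)%nat by lia.
  move=> ->; case: (HP n) => [[_ [_ [T _]]] _]; apply: T => //; exact: pre_length.
have [h Hh] := choice_fun _ Hlim.
exists h; split; [|split].
- move=> x eps He; have [|n Hn1] := half_pow_lt (eps / 2); first lra.
  exists n => x' /agree_pre E; have := Hh x n; have := Hh x' n.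
  have -> : v n x' = v n x by rewrite /v E.
  have := dist_tri (v n x) (h x) (h x'); rewrite (dist_sym (h x) (v n x)); lra.
- move=> w w' Ew; case: (HP (length w)) => [[_ [_ [_ [_ Hdec]]]] _].
  have vap u z k : length u = length w -> exists b, dom (P (length w)) b /\
      v (k + length w)%nat (ap u z) = vert (P (length w)) u b.
    move=> E; have [b [Pb Eb]] := vstep (length w) k (ap u z); exists b.
    by split=> //; rewrite Eb -E pre_ap0.
  have Hsm (eps : R) : eps > 0 -> exists k, (/ 2) ^ (k + length w) < eps.
    move=> /half_pow_lt [k Hk]; exists k.
    apply: Rle_lt_trans Hk; apply: half_pow_le; lia.
  case: (Hdec w w' erefl (esym Ew)) => [Heq|[d [Hd Hsep]]]; [left=> z|right=> z z' E].
  + apply: dist_small => eps He; have [|k Hk] := Hsm (eps / 2); first lra.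
    have Ev : v (k + length w)%nat (ap w z) = v (k + length w)%nat (ap w' z).
      have := ref (length w) (pre z k); rewrite pre_length => /(_ _ (Ha _)) [b [Pb [Vb _]]].
      have := pre_ap w' z k; rewrite -Ew /v pre_ap => ->; rewrite !Vb; exact: Heq.
    have := Hh (ap w z) (k + length w)%nat; have := Hh (ap w' z) (k + length w)%nat.
    rewrite Ev (dist_sym (v _ _) (h (ap w z))) => H1 H2.
    have := dist_tri (v (k + length w)%nat (ap w' z)) (h (ap w z)) (h (ap w' z)); lra.
  + have [|k Hk] := Hsm (d / 2); first lra.
    have [b [Pb Eb]] := vap w z k erefl; have [b' [Pb' Eb']] := vap w' z' k (esym Ew).
    have := Hsep b b' Pb Pb'; rewrite -Eb -Eb'.
    have := Hh (ap w z) (k + length w)%nat; have := Hh (ap w' z') (k + length w)%nat.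
    rewrite -E (dist_sym (v _ (ap w' z'))) => H1 H2.
    have := dist_tri (h (ap w z)) (v (k + length w)%nat (ap w z)) (v (k + length w)%nat (ap w' z')).
    lra.
- move=> n z; apply/HB.
  (* As [B] need not be closed, the edge survives the limit through its witnesses: these converge in
     [Z], and [g1] and [g2] are continuous. *)
  pose c k := edge (P (k + S n)%nat) n (pre z k) (a (k + S n)%nat).
  have [||zz Hzz] := nested_limit c (fun k => (/ 2) ^ k).
  + exact: half_pow_lt.
  + move=> k m Hkm.
    have := ref (k + S n)%nat (pre (shift k z) (m - k)); rewrite pre_length.
    have E : (m - k + (k + S n) = m + S n)%nat by lia.
    rewrite E => /(_ _ (Ha _)) [b [Pb [_ Eb]]].
    have -> : c m = edge (P (k + S n)%nat) n (pre z k) b.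
      by rewrite -Eb -pre_shift /c; congr (edge _ _ (pre z _) _); lia.
    case: (HP (k + S n)%nat) => [[_ [_ [_ [T _]]]] _].
    apply: Rle_trans (_ : (/ 2) ^ (k + S n) <= _); last by apply: half_pow_le; lia.
    apply: T => //; rewrite pre_length; lia.
  exists zz.
  have Hedge k : g1 (c k) = v (k + S n)%nat (ap (false :: s n) z) /\
                 g2 (c k) = v (k + S n)%nat (ap (true :: s n) z).
    case: (HP (k + S n)%nat) => [[[_ [_ [_ He]]] _] _].
    have [|E1 E2] := He n (pre z k) (a (k + S n)%nat) _ (Ha _).
      by rewrite pre_length; lia.
    rewrite /c E1 E2 /v.
    have Hp e : pre (ap (e :: s n) z) (k + S n) = pre z k ++ e :: s n.
      by have := pre_ap (e :: s n) z k; rewrite [length _]/= s_length.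
    by rewrite !Hp.
  have Hlimg (g : Z -> Y) y u : continuous g -> (forall k, g (c k) = v (k + S n)%nat u) ->
      y = h u -> g zz = y.
    move=> Hg Hc ->; apply: dist_small => eps He.
    have [|d [Hd Hgd]] := Hg zz (eps / 2); first lra.
    have [|k Hk] := half_pow_lt (Rmin d (eps / 2)); first by apply: Rmin_glb_lt; lra.
    have := Rmin_l d (eps / 2); have := Rmin_r d (eps / 2) => H1 H2.
    have := Hgd (c k); rewrite dist_sym => /(_ (Rle_lt_trans _ _ _ (Hzz k) (Rlt_le_trans _ _ _ Hk H2))).
    rewrite Hc; have := Hh u (k + S n)%nat; have := half_pow_le k (k + S n)%nat.
    have := dist_tri (v (k + S n)%nat u) (g zz) (h u) => H3 H4 H5 H6.
    have := H4 (Nat.le_add_r _ _); lra.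
  split; [apply: Hlimg cg1 _ erefl|apply: Hlimg cg2 _ erefl] => k; by case: (Hedge k).
Qed.

End Fusion.

(** * Complex situations from twin-free representatives *)

Lemma ap_shift_ge v x k : (length v <= k)%nat -> ap v (shift (length v) x) k = x k.
Proof.
have H z j : ap v z (length v + j) = z j.
  elim: v z j => [//|e v IH] z j /=.
  by have := IH (scons e z) (S j); rewrite Nat.add_succ_r.
move=> Hk; have {1}-> : k = (length v + (k - length v))%nat by lia.
by rewrite H /shift; congr x; lia.
Qed.

Lemma ap_agree v z z' : agree (length v) (ap v z) (ap v z').
Proof. by apply/agree_pre; rewrite !pre_ap0. Qed.

Lemma ap_pre_agree x n z : agree n x (ap (pre x n) z).
Proof. by apply/agree_pre; have := pre_ap0 (pre x n) z; rewrite pre_length => ->. Qed.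

Lemma ap_shift_agree v n (x x' : nat -> bool) : agree n x x' ->
  agree n (ap v (shift (length v) x)) (ap v (shift (length v) x')).
Proof.
move=> H i Hi; case: (Nat.lt_ge_cases i (length v)) => Hiv; first exact: ap_agree.
rewrite !ap_shift_ge //; exact: H.
Qed.

(** Binary digits of positive numbers enumerate all words so that the [n]-th has length at most [n],
    the bound behind [dense_word]. *)
Fixpoint pos_word (p : positive) : word :=
  match p with xH => [] | xO q => false :: pos_word q | xI q => true :: pos_word q end.

Fixpoint word_pos (w : word) : positive :=
  match w with [] => xH | false :: v => xO (word_pos v) | true :: v => xI (word_pos v) end.

Definition nth_word (n : nat) : word := pos_word (Pos.of_succ_nat n).

Lemma nth_word_surj w : exists n, nth_word n = w.
Proof.
have [n Hn] := Pos2Nat.is_succ (word_pos w); exists n.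
rewrite /nth_word (SuccNat2Pos.inv n (word_pos w)) //.
by elim: w {n Hn} => //= -[] w /= ->.
Qed.

Lemma nth_word_length n : (length (nth_word n) <= n)%nat.
Proof.
have H p : (length (pos_word p) < Pos.to_nat p)%nat.
  elim: p => [p|p|] /=; lia.
have := H (Pos.of_succ_nat n); rewrite /nth_word SuccNat2Pos.id_succ; lia.
Qed.

(** * Closed subsets of the Cantor space as Polish spaces *)

Section CantorSubspace.
Implicit Types x y z : nat -> bool.

Definition cdist x y : R :=
  match excluded_middle_informative (x = y) with
  | left _ => 0
  | right _ => (/ 2) ^ epsilon (inhabits O) (fun n => x n <> y n /\ agree n x y)
  end.

Lemma cdist_spec x y : (x = y /\ cdist x y = 0) \/
  exists n, x n <> y n /\ agree n x y /\ cdist x y = (/ 2) ^ n.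
Proof.
rewrite /cdist; case: excluded_middle_informative => [E|E]; first by left.
right; have Hex : exists n, x n <> y n /\ agree n x y.
  have [n0 Hn0] : exists n, x n <> y n.
    apply: NNPP => H; apply: E; apply: functional_extensionality => n.
    by apply: NNPP => Hn; apply: H; exists n.
  elim/(well_founded_induction Wf_nat.lt_wf): n0 Hn0 => n IH Hn.
  case: (classic (agree n x y)) => Ha; first by exists n.
  have [m Hm] := not_all_ex_not _ _ Ha; have [Hm1 Hm2] := imply_to_and _ _ Hm.
  exact: (IH m).
have [H1 H2] := epsilon_spec (inhabits O) _ Hex.
by eexists; split; [exact: H1|split; [exact: H2|]].
Qed.

Lemma cdist_le n x y : agree n x y -> cdist x y <= (/ 2) ^ n.
Proof.
move=> H; case: (cdist_spec x y) => [[_ ->]|[m [Hm [_ ->]]]].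
  exact/Rlt_le/half_pow_pos.
apply: half_pow_le; case: (Nat.lt_ge_cases m n) => // /H; contradiction.
Qed.

Lemma cdist_agree n x y : cdist x y <= (/ 2) ^ n -> agree n x y.
Proof.
case: (cdist_spec x y) => [[-> _] _ //|[m [_ [Ha ->]]] H].
case: (Nat.lt_ge_cases m n) => Hmn; last exact: agree_le Ha.
have := half_pow_le (S m) n Hmn; have := half_pow_pos m; rewrite /= => ? ?; lra.
Qed.

Definition closed_cantor (C : (nat -> bool) -> Prop) :=
  forall x, (forall n, exists y, C y /\ agree n x y) -> C x.

Context (C : (nat -> bool) -> Prop) (closedC : closed_cantor C).

Definition sdist (x y : {x | C x}) : R := cdist (proj1_sig x) (proj1_sig y).

Lemma sdist_metric : is_metric {x | C x} sdist.
Proof.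
split=> [x y|x|x y|x y|x y z]; rewrite /sdist.
- case: (cdist_spec (proj1_sig x) (proj1_sig y)) => [[_ ->]|[n [_ [_ ->]]]]; first lra.
  exact/Rlt_le/half_pow_pos.
- by case: (cdist_spec (proj1_sig x) (proj1_sig x)) => [[_ ->]|[n []]].
- case: (cdist_spec (proj1_sig x) (proj1_sig y)) => [[E _] _|[n [_ [_ ->]]] E].
    case: x y E => [x Hx] [y Hy] /= E; subst y; congr exist; exact: proof_irrelevance.
  have := half_pow_pos n; lra.
- have le x' y' : cdist x' y' <= cdist y' x'.
    case: (cdist_spec y' x') => [[-> ->]|[n [_ [Ha ->]]]]; first lra.
    exact/cdist_le/agree_sym.
  exact: Rle_antisym.
- move: (proj1_sig x) (proj1_sig y) (proj1_sig z) => {}x {}y {}z.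
  case: (cdist_spec x y) => [[-> ->]|[n [_ [Ha ->]]]]; first lra.
  case: (cdist_spec y z) => [[<- ->]|[m [_ [Hb ->]]]].
    have := cdist_le n x y Ha; lra.
  have := cdist_le (min n m) x z (agree_trans _ _ _ _
    (agree_le _ _ _ _ (Nat.le_min_l _ _) Ha) (agree_le _ _ _ _ (Nat.le_min_r _ _) Hb)).
  have := half_pow_pos n; have := half_pow_pos m.
  by case: (Nat.min_spec n m) => [[_ ->]|[_ ->]]; lra.
Qed.

Lemma sdist_complete : complete_metric sdist.
Proof using closedC.
move=> u Hu.
have /choice_fun [N HN] : forall n, exists N, forall k m, (k >= N)%nat -> (m >= N)%nat ->
    agree n (proj1_sig (u k)) (proj1_sig (u m)).
  move=> n; have [N HN] := Hu _ (half_pow_pos n); exists N => k m Hk Hm.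
  exact/cdist_agree/Rlt_le/HN.
pose l i := proj1_sig (u (N (S i))) i.
have Hl n k : (k >= N n)%nat -> agree n l (proj1_sig (u k)).
  move=> Hk i Hi; rewrite /l.
  rewrite (HN (S i) (N (S i)) (max k (N (S i))) _ _ i); try lia.
  apply: (HN n) => //; lia.
have Cl : C l.
  apply: closedC => n; exists (proj1_sig (u (N n))); split; first by case: (u (N n)).
  by apply: Hl; lia.
exists (exist _ l Cl) => eps He; have [n Hn] := half_pow_lt eps He.
exists (N n) => k Hk; apply: Rle_lt_trans Hn; exact/cdist_le/agree_sym/Hl.
Qed.

Lemma sdist_separable : separable_metric sdist.
Proof.
have /choice_fun [s Hs] : forall n, exists o : option {x | C x},
    forall x : {x | C x}, pre (proj1_sig x) (length (nth_word n)) = nth_word n ->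
      exists y : {x | C x}, o = Some y /\ pre (proj1_sig y) (length (nth_word n)) = nth_word n.
  move=> n.
  case: (classic (exists x : {x | C x}, pre (proj1_sig x) (length (nth_word n)) = nth_word n)).
    by move=> [x Hx]; exists (Some x) => _ _; exists x.
  by move=> H; exists None => x Hx; case: H; exists x.
exists s => x eps He; have [n Hn] := half_pow_lt eps He.
have [k Hk] := nth_word_surj (pre (proj1_sig x) n).
have [|y [E]] := Hs k x; first by rewrite Hk pre_length.
rewrite Hk pre_length => Hy; exists k, y; split=> //.
apply: Rle_lt_trans Hn; apply: cdist_le; exact/agree_pre.
Qed.

Definition cantor_sub : Polish := {|
  pt := {x | C x};
  dist := sdist;
  dist_metric := sdist_metric;
  dist_complete := sdist_complete;
  dist_separable := sdist_separable |}.

Lemma cantor_sub_ball (U : cantor_sub -> Prop) : is_open U <->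
  forall x : cantor_sub, U x -> exists n, forall y : cantor_sub, agree n (proj1_sig x) (proj1_sig y) -> U y.
Proof.
split=> H x /H.
  move=> [e [/half_pow_lt [n Hn] He]]; exists n => y Hy; apply: He.
  exact: Rle_lt_trans (cdist_le _ _ _ Hy) Hn.
move=> [n Hn]; exists ((/ 2) ^ n); split; first exact: half_pow_pos.
move=> y Hy; exact/Hn/cdist_agree/Rlt_le.
Qed.

End CantorSubspace.

(** * Twin words and canonical representatives *)

Section Twins.
Context {Y : Polish} (h : (nat -> bool) -> Y).
Hypothesis h_cont : cantor_cont h.
Hypothesis h_dich : dichotomous h.

Lemma twins_sym p q : twins h p q -> twins h q p.
Proof. by move=> H z; rewrite H. Qed.

Lemma twins_trans p q r : twins h p q -> twins h q r -> twins h p r.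
Proof. by move=> H H' z; rewrite H H'. Qed.

Lemma twins_app w p q : twins h p q -> twins h (w ++ p) (w ++ q).
Proof. by move=> H z; rewrite !ap_app H. Qed.

(** Words that are not twins have disjoint images on their cones, and these stay disjoint on smaller
    cones. *)
Lemma twins_down p q w w' : length p = length q -> twins h (w ++ p) (w' ++ q) -> twins h p q.
Proof.
move=> /h_dich [//|H] /(_ (fun _ => false)); rewrite !ap_app => E.
by case: (H _ _ E).
Qed.

Definition splits (p : word) := ~ twins h (false :: p) (true :: p).

Lemma splits_twins p q : twins h p q -> splits p -> splits q.
Proof.
move=> H Hp Hq; apply: Hp.
apply: twins_trans (twins_app [false] _ _ H) _; apply: twins_trans Hq _.
exact/twins_sym/(twins_app [true]).
Qed.

Lemma twins_cons p q e e' : twins h p q -> (splits p -> e = e') -> twins h (e :: p) (e' :: q).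
Proof.
move=> H He; apply: (twins_trans _ (e' :: p)); last exact: (twins_app [e']).
case: (classic (twins h (false :: p) (true :: p))) => [Ht|/He -> //].
by case: e e' {He} => [] [] //; apply: twins_sym.
Qed.

Lemma twins_limit n0 x y :
  (forall n, (n0 <= n)%nat -> twins h (pre x n) (pre y n)) -> h x = h y.
Proof using h_cont.
move=> H; apply: dist_small => eps He.
have [|n Hn] := h_cont x (eps / 2); first lra.
have [|m Hm] := h_cont y (eps / 2); first lra.
pose N := (n0 + n + m)%nat; pose cut x := ap (pre x N) (fun _ => false).
have cutP u : agree N u (cut u) by exact: ap_pre_agree.
have E : h (cut x) = h (cut y) by apply: H; rewrite /N; lia.
have := Hn (cut x) (agree_le _ _ _ _ _ (cutP x)); have := Hm (cut y) (agree_le _ _ _ _ _ (cutP y)).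
rewrite E /N => /(_ ltac:(lia)) H1 /(_ ltac:(lia)) H2.
have := dist_tri (h (cut y)) (h x) (h y); rewrite (dist_sym (h (cut y)) (h y)); lra.
Qed.

Lemma twins_of_eq x y n : h x = h y -> twins h (pre x n) (pre y n).
Proof using h_dich.
move=> E; have [|//|H] := h_dich (pre x n) (pre y n); first by rewrite !pre_length.
by case: (H (shift n x) (shift n y)); rewrite !ap_pre_shift.
Qed.

Definition canonical x := forall l, ~ splits (pre x l) -> x l = false.

(** Splitting is tested on the prefixes of [x], not on the corrected ones. The two are twins, so the
    result is canonical all the same. *)
Definition canon x : nat -> bool := fun l =>
  match excluded_middle_informative (splits (pre x l)) with left _ => x l | right _ => false end.

Lemma canon_twins x n : twins h (pre (canon x) n) (pre x n).
Proof.
elim: n => [|n IH] //=; apply: twins_cons => // Hs.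
rewrite /canon; case: excluded_middle_informative => // Hn.
by case: Hn; apply: splits_twins Hs.
Qed.

Lemma h_canon x : h (canon x) = h x.
Proof using h_cont. by apply: (twins_limit 0) => n _; exact: canon_twins. Qed.

Lemma canon_canonical x : canonical (canon x).
Proof.
move=> l Hl; rewrite {1}/canon; case: excluded_middle_informative => // H; case: Hl.
exact: splits_twins (twins_sym _ _ (canon_twins x l)) H.
Qed.

Lemma canon_splits x l : splits (pre x l) -> canon x l = x l.
Proof. by rewrite /canon; case: excluded_middle_informative. Qed.

Lemma canon_id x : canonical x -> canon x = x.
Proof.
move=> H; apply: functional_extensionality => l; rewrite /canon.
by case: excluded_middle_informative => // /H.
Qed.

Lemma canon_agree n x y : agree n x y -> agree n (canon x) (canon y).
Proof.
move=> H l Hl; rewrite /canon.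
have -> : pre x l = pre y l by apply/agree_pre; apply: agree_le H; lia.
by rewrite (H l Hl).
Qed.

(** Equal images force twin prefixes. Inductively the digits agree: after a splitting word different
    digits would destroy twinship, and after any other word both digits are [false]. *)
Lemma canonical_inj x y : canonical x -> canonical y -> h x = h y -> x = y.
Proof using h_dich.
move=> Hx Hy E; have Hpre n : pre x n = pre y n.
  elim: n => //= n IH; have := twins_of_eq x y (S n) E; rewrite /= IH => Ht.
  case: (classic (splits (pre y n))) => Hs.
    congr cons; case: (x n) (y n) Ht => [] [] // Ht; case: Hs => //.
  by rewrite (Hx n) ?(Hy n) // IH.
apply: functional_extensionality => n; exact: (proj2 (agree_pre (S n) x y) (Hpre (S n))).
Qed.

Lemma canonical_closed : closed_cantor canonical.
Proof.
move=> x H l; have [y [Hy Ha]] := H (S l).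
have -> : pre x l = pre y l by apply/agree_pre; apply: agree_le Ha; lia.
rewrite (Ha l) //; exact: Hy.
Qed.

Definition forward p q := forall w, splits (w ++ q) -> splits (w ++ p).

Definition base (B : Y -> Y -> Prop) p q :=
  length p = length q /\ linked h B p q /\ forward p q.

(* The space consists of one canonical representative of each point of the range of [h]. If
   no extension of [q] splits without the corresponding extension of [p], then replacing the
   prefix [p] by [q] and taking representatives is an open map. *)
Lemma complex_situation_of_base (B : Y -> Y -> Prop) : digraph B ->
  (forall w, exists u v, base B (u ++ w) (v ++ w)) ->
  exists (X : Polish) (f : nat -> pmap X), complex_situation X f /\ inj_c_le (Af f) B.
Proof using h_cont h_dich.
move=> Birr Hbase.
pose X := cantor_sub canonical canonical_closed.
pose val (x : X) : nat -> bool := proj1_sig x.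
have valK (x y : X) : val x = val y -> x = y.
  case: x y => [x Hx] [y Hy] /= E; subst y; congr exist; exact: proof_irrelevance.
pose mk x : X := exist _ (canon x) (canon_canonical x).
pose F p q : pmap X := {|
  pdom := fun x => base B p q /\ twins h (pre (val x) (length p)) p;
  pfun := fun x => mk (ap q (shift (length p) (val x))) |}.
pose f k := F (nth_word (fst (Cantor.of_nat k))) (nth_word (snd (Cantor.of_nat k))).
have fF p q : exists k, f k = F p q.
  have [i <-] := nth_word_surj p; have [j <-] := nth_word_surj q.
  by exists (Cantor.to_nat (i, j)); rewrite /f Cantor.cancel_of_to.
have hF p q x : pdom (F p q) x -> B (h (val x)) (h (val (pfun (F p q) x))).
  move=> [[_ [L _]] Ht]; rewrite /= h_canon.
  by rewrite -{1}(ap_pre_shift (length p) (val x)) Ht; exact: L.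
have fagree p q n x y : length p = length q -> agree n (val x) (val y) ->
    agree n (val (pfun (F p q) x)) (val (pfun (F p q) y)).
  by move=> E H; apply: canon_agree; rewrite E; exact: ap_shift_agree.
have dopen p q : is_open (pdom (F p q)).
  apply/cantor_sub_ball => x [Hb Ht]; exists (length p) => y /agree_pre E.
  by split=> //; rewrite /val -E.
have fopen p q : popen (F p q).
  move=> U /cantor_sub_ball HU UD; apply/cantor_sub_ball => y [x [Ux <-]].
  have [[Epq [_ Hf]] Ht] := UD x Ux; have [m Hm] := HU x Ux.
  pose n := (m + length p)%nat; exists n => y' Hy'.
  (* The preimage of [y'] is the canonical form of [r]: the digits of [x] below [n], then those of
     [y']. *)
  pose r := ap (pre (val x) n) (shift n (val y')).
  have Hx' : agree n (val x) (canon r).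
    rewrite -{1}(canon_id (val x)); first exact: (proj2_sig x).
    apply: canon_agree; exact: ap_pre_agree.
  exists (mk r); split; first by apply: Hm; apply: agree_le Hx'; rewrite /n; lia.
  apply: valK; apply: canonical_inj; [exact: canon_canonical|exact: (proj2_sig y')|].
  rewrite /= h_canon; set y'' := ap q _.
  (* The prefixes of [y''] and [y'] stay twins. If that of [y''] splits, [forward] makes the
     corresponding prefix of [r] split; then [canon] keeps the digit of [r], which is that of
     [y']. *)
  apply: (twins_limit n) => l; elim=> [|k Hk IH].
    have Ey : agree n y'' (ap q (shift (length p) (val x))).
      by rewrite /y'' Epq; apply: ap_shift_agree; exact: agree_sym.
    rewrite (proj1 (agree_pre _ _ _) Ey) -(proj1 (agree_pre _ _ _) Hy').
    exact/twins_sym/canon_twins.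
  apply: twins_cons => // Hs.
  have -> : y'' k = canon r k by rewrite /y'' Epq ap_shift_ge // -Epq; rewrite /n in Hk; lia.
  have -> : val y' k = r k.
    by have := ap_shift_ge (pre (val x) n) (val y') k; rewrite pre_length /r => ->.
  apply: canon_splits.
  pose w := pre (shift (length p) (canon r)) (k - length p).
  have Hw : splits (w ++ p).
    apply: Hf; have := pre_ap q (shift (length p) (canon r)) (k - length p).
    rewrite -/w -Epq => <-.
    have -> : (k - length p + length p = k)%nat by lia.
    exact: Hs.
  apply: splits_twins (canon_twins r k) _; apply: splits_twins Hw.
  have -> : pre (canon r) k = w ++ pre (canon r) (length p).
    by rewrite /w -pre_shift; congr pre; lia.
  apply: twins_app; apply: twins_sym.
  have Ep : agree (length p) (val x) (canon r) by apply: agree_le Hx'; rewrite /n; lia.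
  by rewrite -(proj1 (agree_pre _ _ _) Ep).
exists X, f; split; [split; [|split]|].
- by constructor; exact: (mk (fun _ => false)).
- move=> k; rewrite /f; set p := nth_word _; set q := nth_word _.
  split; [exact: dopen|split; [|split=> //]].
    by apply: fopen; [exact: dopen|].
  move=> x eps [[E _] _] He; have [n Hn] := half_pow_lt eps He.
  exists ((/ 2) ^ n); split; first exact: half_pow_pos.
  move=> y _ Hy; apply: Rle_lt_trans Hn; apply: cdist_le; apply: fagree => //.
  exact/cdist_agree/Rlt_le.
- move=> x; split; last by move=> [k [/hF H E]]; move: H; rewrite -/(f k) E; exact: Birr.
  move=> eps He; have [n Hn] := half_pow_lt eps He.
  (* A base pair extending a long prefix of [x] gives an edge with both ends near [x]. *)
  have [u [v Huv]] := Hbase (pre (val x) n).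
  move: Huv; set p := u ++ _; set q := v ++ _ => Huv.
  have close w z : agree n (val x) (canon (ap (w ++ pre (val x) n) z)).
    rewrite -{1}(canon_id (val x)); first exact: (proj2_sig x).
    by apply: canon_agree; rewrite ap_app; exact: ap_pre_agree.
  have [k Ek] := fF p q.
  exists (mk (ap p (fun _ => false))), (pfun (F p q) (mk (ap p (fun _ => false)))).
  split; [|split].
  + exists k; rewrite Ek; split=> //; split=> //.
    by have := canon_twins (ap p (fun _ => false)) (length p); rewrite pre_ap0.
  + by apply: Rle_lt_trans Hn; apply: cdist_le; exact: close.
  + by apply: Rle_lt_trans Hn; apply: cdist_le; exact: close.
- exists (fun x => h (val x)); split; [|split].
  + move=> x y E; apply: valK; apply: canonical_inj E; exact: proj2_sig.
  + move=> x eps He; have [n Hn] := h_cont (val x) eps He.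
    exists ((/ 2) ^ n); split; first exact: half_pow_pos.
    move=> y Hy; apply: Hn; exact/cdist_agree/Rlt_le.
  + by move=> x y [k [Hk <-]]; exact: hF.
Qed.

End Twins.

(** * Injective homomorphisms and the dichotomy *)

Lemma word_limit (V : nat -> word) :
  (forall j, exists w, V (S j) = w ++ V j) -> (forall j, (j <= length (V j))%nat) ->
  exists x, forall j, pre x (length (V j)) = V j.
Proof.
move=> Hstep Hlen.
have mono i j : (i <= j)%nat -> exists w, V j = w ++ V i.
  elim=> [|k _ [w Hw]]; first by exists [].
  have [w' ->] := Hstep k; exists (w' ++ w); by rewrite Hw app_assoc.
pose x i := ap (V (S i)) (fun _ => false) i.
exists x => j; rewrite -{2}(pre_ap0 (V j) (fun _ => false)); apply/agree_pre => i Hi.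
have H k : (k <= j + S i)%nat -> (i < length (V k))%nat ->
    ap (V k) (fun _ => false) i = ap (V (j + S i)%nat) (fun _ => false) i.
  move=> Hk Hik; have [w ->] := mono _ _ Hk; rewrite ap_app.
  by rewrite (ap_agree (V k) (fun _ => false) (ap w (fun _ => false)) i Hik).
rewrite /x H ?(H j) //; try lia.
Qed.

(** * A second fusion producing an injective homomorphism *)

Section Separation.
Context {Y : Polish} (h : (nat -> bool) -> Y) (B : Y -> Y -> Prop) (s : nat -> word).
Hypothesis h_cont : cantor_cont h.
Hypothesis h_dich : dichotomous h.
Hypothesis B_irr : digraph B.
Hypothesis s_length : forall n, length (s n) = n.
Hypothesis linked_dense : forall w, exists w',
  linked h B (false :: w' ++ w) (true :: w' ++ w).
Hypothesis linked_not_forward : forall u v, length u = length v -> linked h B u v ->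
  (exists w, splits h (w ++ v) /\ ~ splits h (w ++ u)) /\
  (exists w, splits h (w ++ u) /\ ~ splits h (w ++ v)).

(** Stage [S k] of the G0 graph: two copies of stage [k], told apart by the last digit and joined by
    one edge between the copies of [s k]. *)
Inductive tedge : nat -> word -> word -> Prop :=
  | tedge_new k : tedge (S k) (false :: s k) (true :: s k)
  | tedge_old k e a b : tedge k a b -> tedge (S k) (e :: a) (e :: b).

Lemma tedge_length k a b : tedge k a b -> length a = k /\ length b = k.
Proof using s_length. by elim=> {k a b} [k|k e a b _ [Ha Hb]] /=; rewrite ?s_length ?Ha ?Hb. Qed.

(* The graph [tedge k] is a tree: removing the edge between [p] and [t] leaves the two
   components separated by [sd]. *)
Lemma tedge_bridge k (Q : word -> Prop) r : length r = k -> Q r ->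
  ~ (forall a, length a = k -> Q a) ->
  exists p t (sd : word -> bool), (tedge k p t \/ tedge k t p) /\ Q p /\ ~ Q t /\
    sd r = false /\ sd p = false /\ sd t = true /\
    forall a b, tedge k a b -> sd a = sd b \/ (a = p /\ b = t) \/ (a = t /\ b = p).
Proof using s_length.
elim: k Q r => [|k IH] Q r.
  by case: r => // _ Q0 []; case.
case: r => // e r [Hr] Qr Hn.
(* Recursion into the half [e0]. Its root is [r] if it contains the given root, and otherwise [s k],
   where paths from the other half enter; on that other half [sd'] is constant. *)
have lift e0 r0 : length r0 = k -> Q (e0 :: r0) -> ~ (forall a, length a = k -> Q (e0 :: a)) ->
    (e = e0 /\ r = r0) \/ (e <> e0 /\ s k = r0) ->
    exists p t (sd : word -> bool), (tedge (S k) p t \/ tedge (S k) t p) /\ Q p /\ ~ Q t /\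
      sd (e :: r) = false /\ sd p = false /\ sd t = true /\
      forall a b, tedge (S k) a b -> sd a = sd b \/ (a = p /\ b = t) \/ (a = t /\ b = p).
  move=> Hr0 Q0 Hn0 Hcase.
  have [p [t [sd [He [Qp [Qt [Sr [Sp [St Hsd]]]]]]]]] := IH (fun a => Q (e0 :: a)) r0 Hr0 Q0 Hn0.
  pose sd' a := match a with
    | [] => false | e1 :: a => match Bool.eqb e1 e0 with true => sd a | false => sd (s k) end end.
  have sdE a : sd' (e0 :: a) = sd a by rewrite /= Bool.eqb_reflx.
  exists (e0 :: p), (e0 :: t), sd'; rewrite !sdE; split.
    by case: He => He; [left|right]; exact: tedge_old.
  do 2 (split; first done); split.
    case: Hcase => [[-> ->]|[Hee Hsk]]; first by rewrite sdE.
    rewrite /=; have -> : Bool.eqb e e0 = false by apply/Bool.eqb_false_iff.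
    by rewrite Hsk.
  do 2 (split; first done).
  move=> a b Hab; inversion Hab as [k' E1 E2 E3|k' e1 a' b' Hab' E1 E2 E3]; subst.
    left=> /=; by case: (e0).
  case: (Bool.bool_dec e1 e0) => [E|E]; last first.
    by left=> /=; have -> : Bool.eqb e1 e0 = false by apply/Bool.eqb_false_iff.
  subst e1; rewrite !sdE; case: (Hsd _ _ Hab') => [|[[-> ->]|[-> ->]]]; auto.
case: (classic (forall a, length a = k -> Q (e :: a))) => Hall; last first.
  by apply: (lift e r) => //; left.
case: (classic (Q (negb e :: s k))) => Qs.
  apply: (lift (negb e) (s k)) => //; last by right; split=> //; case: (e).
  move=> Hall'; apply: Hn => -[//|e1 a] [Ha].
  case: (Bool.bool_dec e1 e) => [->|E]; first exact: Hall.
  have -> : e1 = negb e by case: (e1) (e) E => [] [].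
  exact: Hall'.
(* Here [Q] holds on the whole half of the root and fails at [negb e :: s k], so the joining edge is
   the bridge. *)
exists (e :: s k), (negb e :: s k), (fun a => match a with [] => false | e1 :: _ => xorb e e1 end).
split; first by case: (e); [right|left]; exact: tedge_new.
split; first exact: Hall.
split=> //; split; first by case: (e).
split; first by case: (e).
split; first by case: (e).
move=> a b Hab; inversion Hab as [k' E1 E2 E3|k' e1 a' b' Hab' E1 E2 E3]; subst; last by left.
right; by case: (e); [right|left].
Qed.

(** Both ends are prolonged by the same word, but only up to twins: an end that does not split may
    carry a different actual digit. *)
Definition common_ext p q p' q' := exists w, length p' = length (w ++ p) /\
  twins h p' (w ++ p) /\ twins h q' (w ++ q).

Lemma common_ext_trans p q p1 q1 p2 q2 :
  common_ext p q p1 q1 -> common_ext p1 q1 p2 q2 -> common_ext p q p2 q2.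
Proof.
move=> [w [L [T1 T2]]] [w' [L' [T1' T2']]]; exists (w' ++ w); rewrite -!app_assoc.
split; first by rewrite L' !length_app L length_app.
by split; [apply: twins_trans T1' _|apply: twins_trans T2' _]; exact: twins_app.
Qed.

Lemma linked_common_ext p q p' q' : common_ext p q p' q' -> linked h B p q -> linked h B p' q'.
Proof. move=> [w [_ [T1 T2]]] L z; rewrite T1 T2 !ap_app; exact: L. Qed.

Definition layout k L (U : word -> word) := (forall a, length a = k -> length (U a) = L) /\
  forall a b, tedge k a b -> linked h B (U a) (U b).

Definition apart k (U : word -> word) :=
  forall a b, length a = k -> length b = k -> a <> b -> ~ twins h (U a) (U b).

(** Vertices are prolonged literally, so that branches converge; edges only up to twins, which
    preserves [linked]. *)
Definition extends k (U U' : word -> word) :=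
  (forall a, length a = k -> exists w, U' a = w ++ U a) /\
  (forall a b, tedge k a b -> common_ext (U a) (U b) (U' a) (U' b)).

Lemma extends_trans k U U1 U2 : extends k U U1 -> extends k U1 U2 -> extends k U U2.
Proof.
move=> [P1 C1] [P2 C2]; split=> [a Ha|a b Hab]; last exact: common_ext_trans (C1 _ _ Hab) (C2 _ _ Hab).
have [w E] := P1 a Ha; have [w' ->] := P2 a Ha; exists (w' ++ w); by rewrite E app_assoc.
Qed.

Lemma not_twins_ext p q w w' : length p = length q ->
  ~ twins h p q -> ~ twins h (w ++ p) (w' ++ q).
Proof using h_dich. move=> E H /(twins_down _ h_dich) Ht; apply: H; exact: Ht. Qed.

(* The two copies [U (false :: t)] and [U (true :: t)] are told apart along an edge from [t]
   towards [s k] whose far end [p] is already fine: prolong so that the [t]-end splits and the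
   [p]-end does not, then give different digits to the two sides of that edge. *)
Lemma separate_copies k n L U (l : list word) : (length l <= n)%nat ->
  layout (S k) L U ->
  (forall e e' a b, length a = k -> length b = k -> a <> b ->
     ~ twins h (U (e :: a)) (U (e' :: b))) ->
  ~ twins h (U (false :: s k)) (U (true :: s k)) ->
  (forall a, length a = k -> twins h (U (false :: a)) (U (true :: a)) -> In a l) ->
  exists L' U', (L <= L')%nat /\ layout (S k) L' U' /\ apart (S k) U' /\ extends (S k) U U'.
Proof using h_dich s_length linked_not_forward.
(* Induction on a bound for the number of words whose two copies are still twins; [Q] holds at the
   others. *)
elim: n L U l => [|n IH] L U l Hl [UL Ul] Hab Hs Hin;
  pose Q a := ~ twins h (U (false :: a)) (U (true :: a));
  case: (classic (forall a, length a = k -> Q a)) => HQ.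
1,3: exists L, U; split=> //; split=> //; split; last by
  split=> [a _|a b Hab']; [exists []|exists []].
1,2: move=> [//|e a] [//|e' b] [Ha] [Hb] Hne;
  case: (classic (a = b)) => [E|]; [subst b|exact: Hab];
  have := HQ a Ha; rewrite /Q; case: e e' Hne => [] [] // _ H /twins_sym; try exact: H;
  by move/twins_sym.
1: by case: HQ => a Ha /(Hin a Ha); move: Hl; case: (l) => //= *; lia.
have [p [t [sd [He [Qp [Qt [Sr [Sp [St Hsd]]]]]]]]] := tedge_bridge k Q (s k) (s_length k) Hs HQ.
have [lp lt] : length p = k /\ length t = k.
  by case: He => /tedge_length [].
have Htt : twins h (U (false :: t)) (U (true :: t)) by exact: NNPP.
(* Either end of a linked pair can be made to split alone, so the direction of the edge between [p]
   and [t] is irrelevant. *)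
have [w [Hw1 Hw2]] : exists w, splits h (w ++ U (false :: t)) /\ ~ splits h (w ++ U (false :: p)).
  have El : length (U (false :: p)) = length (U (false :: t)) by rewrite !UL //= ?lp ?lt.
  case: He => /(tedge_old _ false) /Ul Hlink.
    by case: (linked_not_forward _ _ El Hlink).
  by case: (linked_not_forward _ _ (esym El) Hlink).
(* Only copies [false :: a] beyond the bridge receive [true]. The one edge with unequal digits is
   then the bridge in the [false] copy, and its [p]-end does not split, so there the digit can be
   read as [true] up to twins. *)
pose dg c := match c with false :: a => sd a | _ => false end.
pose V c := dg c :: w ++ U c.
have HV : extends (S k) U V.
  split=> [c _|c d Hcd]; first by exists (dg c :: w).
  have same : dg c = dg d -> common_ext (U c) (U d) (V c) (V d).
    by move=> E; exists (dg c :: w); rewrite /V -E; split.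
  inversion Hcd as [k' E1 E2 E3|k' e a b Hab' E1 E2 E3]; subst.
    by apply: same; rewrite /= Sr.
  case: e same Hcd => same Hcd; first exact: same.
  case: (Hsd _ _ Hab') => [E|H]; first exact: same.
  exists (true :: w); rewrite /V /=; split=> //.
  have Tp : twins h (false :: w ++ U (false :: p)) (true :: w ++ U (false :: p)).
    exact: twins_cons.
  by case: H => [[-> ->]|[-> ->]]; rewrite Sp St.
have VL c : length c = S k -> length (V c) = (S (length w + L))%nat.
  by move=> Hc; rewrite /V /= length_app UL.
have Vsep c d : length c = S k -> length d = S k -> ~ twins h (U c) (U d) -> ~ twins h (V c) (V d).
  move=> Hc Hd; apply: (not_twins_ext _ _ (dg c :: w) (dg d :: w)); by rewrite !UL.
have [|||||L' [U' [HL [lay [ap' ext']]]]] :=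
  IH (S (length w + L)) V (remove (list_eq_dec Bool.bool_dec) t l).
- apply/Nat.lt_succ_r; apply: Nat.lt_le_trans Hl.
  exact: remove_length_lt (Hin t lt Htt).
- split=> // a b Hab'; exact: linked_common_ext (proj2 HV _ _ Hab') (Ul _ _ Hab').
- move=> e e' a b Ha Hb Hne; apply: Vsep; rewrite /= ?Ha ?Hb //; exact: Hab.
- by apply: Vsep => //=; rewrite s_length.
- move=> a Ha HT; have HUa : twins h (U (false :: a)) (U (true :: a)).
    apply: NNPP => H.
    by apply: (Vsep (false :: a) (true :: a) _ _ H HT); rewrite /= Ha.
  apply: in_in_remove; last exact: Hin.
  (* The copies of [t] were twins and receive different digits; were they still twins,
     [w ++ U (false :: t)] would not split. *)
  move=> E; subst a; apply: Hw1.
  have T1 := twins_app h w _ _ Htt.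
  apply: (twins_trans _ _ (false :: w ++ U (true :: t))); first exact: (twins_app h [false]).
  by apply: twins_sym; move: HT; rewrite /V /= St.
exists L', U'; split; first lia.
split=> //; split=> //; exact: extends_trans HV ext'.
Qed.

(** Two copies of [U] are prolonged by a common word that links the copies of [s k]. Irreflexivity
    of [B] keeps these from being twins, which gives [separate_copies] its starting point. *)
Lemma double_layout k L U : layout k L U -> apart k U ->
  exists L' U', (L < L')%nat /\ layout (S k) L' U' /\ apart (S k) U' /\
    forall e, (forall a, length a = k -> exists w, U' (e :: a) = w ++ U a) /\
      forall a b, tedge k a b -> common_ext (U a) (U b) (U' (e :: a)) (U' (e :: b)).
Proof using h_dich s_length linked_not_forward linked_dense B_irr.
move=> [UL Ul] Hap; have [w Hw] := linked_dense (U (s k)).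
pose V c := match c with [] => [] | e :: a => e :: w ++ U a end.
have VC e a b : tedge k a b -> common_ext (U a) (U b) (V (e :: a)) (V (e :: b)).
  by move=> _; exists (e :: w).
have layV : layout (S k) (S (length w + L)) V.
  split=> [[//|e a] [Ha]|c d Hcd]; first by rewrite /= length_app UL.
  inversion Hcd as [k' E1 E2 E3|k' e a b Hab' E1 E2 E3]; subst; first exact: Hw.
  exact: linked_common_ext (VC e _ _ Hab') (Ul _ _ Hab').
have [|||L' [U' [HL [lay [ap' [E1 E2]]]]]] :=
  separate_copies k _ _ V (all_words k) (le_n _) layV.
- move=> e e' a b Ha Hb Hne; apply: (not_twins_ext _ _ (e :: w) (e' :: w)).
    by rewrite !UL.
  exact: Hap.
- move=> HT; have := Hw (fun _ => false); move: (HT (fun _ => false)) => /= ->; exact: B_irr.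
- by move=> a Ha _; exact: all_words_In.
exists L', U'; split; first lia.
split=> //; split=> // e; split=> [a Ha|a b Hab].
  have [|w' ->] := E1 (e :: a); first by rewrite /= Ha.
  by exists (w' ++ e :: w); rewrite /= -app_assoc.
exact: common_ext_trans (VC e _ _ Hab) (E2 _ _ (tedge_old _ e _ _ Hab)).
Qed.

Lemma twins_limit_cofinal x y :
  (forall n, exists m, (n <= m)%nat /\ twins h (pre x m) (pre y m)) -> h x = h y.
Proof using h_cont h_dich.
move=> H; apply: (twins_limit h h_cont 0) => n _; have [m [Hnm Hm]] := H n.
have E u : pre u m = pre (shift n u) (m - n) ++ pre u n.
  by rewrite -pre_shift; congr pre; lia.
rewrite !E in Hm; apply: twins_down Hm => //; by rewrite !pre_length.
Qed.

(** Along each branch [x] the words [U k] grow to a sequence [c x], and apartness at all levels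
    makes [h (c x)] injective in [x]. *)
Lemma injective_hom : exists g : (nat -> bool) -> Y, cantor_cont g /\
  (forall x y, g x = g y -> x = y) /\ forall n, linked g B (false :: s n) (true :: s n).
Proof using h_cont h_dich s_length linked_not_forward linked_dense B_irr.
have [||f [f0 Hf]] := dep_choice
  (fun k p => layout k (fst p) (snd p) /\ apart k (snd p))
  (fun k p q => (fst p < fst q)%nat /\ forall e,
     (forall a, length a = k -> exists w, snd q (e :: a) = w ++ snd p a) /\
     forall a b, tedge k a b ->
       common_ext (snd p a) (snd p b) (snd q (e :: a)) (snd q (e :: b)))
  (O, fun _ => []).
- split; first by split=> // a b Hab; inversion Hab.
  by move=> [] // [].
- move=> k [L U] [HL HA]; have [L' [U' [H1 [H2 [H3 H4]]]]] := double_layout k L U HL HA.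
  by exists (L', U').
pose L k := fst (f k); pose U k := snd (f k).
have Llt k : (L k < L (S k))%nat by case: (Hf k) => _ [].
have Lge k : (k <= L k)%nat by elim: k => [|k IH]; [lia|have := Llt k; lia].
have UL k x : length (U k (pre x k)) = L k.
  by case: (Hf k) => [[[H _] _] _]; apply: H; rewrite pre_length.
have /choice_fun [c Hc] : forall x, exists y, forall k, pre y (L k) = U k (pre x k).
  move=> x; have [||y Hy] := word_limit (fun k => U k (pre x k)).
  - move=> k; case: (Hf k) => _ [_ /(_ (x k)) [H _]]; apply: H; exact: pre_length.
  - move=> k; rewrite UL; exact: Lge.
  by exists y => k; rewrite -{1}(UL k x) Hy.
exists (fun x => h (c x)); split; [|split].
- move=> x eps He; have [n Hn] := h_cont (c x) eps He; exists n => x' /agree_pre E.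
  by apply: Hn; apply: agree_le (Lge n) _; apply/agree_pre; rewrite !Hc E.
- move=> x y E; apply: functional_extensionality => n; apply: NNPP => Hne.
  have Hp : pre x (S n) <> pre y (S n) by move=> [].
  case: (Hf (S n)) => [[_ Hap] _].
  apply: (Hap _ _ (pre_length x _) (pre_length y _) Hp).
  by rewrite -/(U (S n)) -!Hc; exact: twins_of_eq.
- move=> n z; set x := ap _ z; set y := ap _ z.
  have Hx j : pre x (j + S n) = pre z j ++ false :: s n.
    by have := pre_ap (false :: s n) z j; rewrite [length _]/= s_length.
  have Hy j : pre y (j + S n) = pre z j ++ true :: s n.
    by have := pre_ap (true :: s n) z j; rewrite [length _]/= s_length.
  have Htree j : tedge (j + S n) (pre x (j + S n)) (pre y (j + S n)).
    rewrite Hx Hy; elim: j => [|j IH]; [exact: tedge_new|exact: tedge_old].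
  have /choice_fun [w Hw] : forall j, exists w,
      length (U (S j + S n)%nat (pre x (S j + S n))) =
        length (w ++ U (j + S n)%nat (pre x (j + S n))) /\
      twins h (U (S j + S n)%nat (pre x (S j + S n))) (w ++ U (j + S n)%nat (pre x (j + S n))) /\
      twins h (U (S j + S n)%nat (pre y (S j + S n))) (w ++ U (j + S n)%nat (pre y (j + S n))).
    move=> j; case: (Hf (j + S n)%nat) => _ [_ /(_ (z j)) [_ H]].
    have Ex : pre x (S j + S n) = z j :: pre x (j + S n) by rewrite !Hx.
    have Ey : pre y (S j + S n) = z j :: pre y (j + S n) by rewrite !Hy.
    by rewrite Ex Ey; exact: H (Htree j).
  (* The common words added along the edge accumulate to [zeta]. The sequences [c x] and [c y] need
     not end in [zeta], but their prefixes are twins of the words at level [S n] prolonged along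
     [zeta], so [h] takes the same values. *)
  pose W := fix W j := match j with O => [] | S i => w i ++ W i end.
  have HW j : length (W j) = (L (j + S n) - L (S n))%nat /\ (j <= length (W j))%nat.
    have Lle i : (L (S n) <= L (i + S n))%nat by elim: i => //= i; have := Llt (i + S n)%nat; lia.
    elim: j => [|j [E1 E2]]; first by split=> /=; lia.
    have [El _] := Hw j; rewrite length_app !UL in El.
    have := Llt (j + S n)%nat; have := Lle j; have := Lle (S j).
    have EW : length (W (S j)) = (length (w j) + length (W j))%nat by exact: length_app.
    rewrite EW; move: El => /=; lia.
  have HT j : twins h (U (j + S n)%nat (pre x (j + S n))) (W j ++ U (S n) (pre x (S n))) /\
              twins h (U (j + S n)%nat (pre y (j + S n))) (W j ++ U (S n) (pre y (S n))).
    elim: j => [|j [IH1 IH2]]; first by split.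
    have [_ [T1 T2]] := Hw j; have -> : W (S j) = w j ++ W j by [].
    rewrite -!app_assoc; by split; [apply: twins_trans T1 _|apply: twins_trans T2 _]; exact: twins_app.
  have [|j|zeta Hz] := word_limit W; first by move=> j; exists (w j).
    by case: (HW j).
  have key u : (forall j, twins h (U (j + S n)%nat (pre u (j + S n))) (W j ++ U (S n) (pre u (S n)))) ->
      h (c u) = h (ap (U (S n) (pre u (S n))) zeta).
    move=> Hu; apply: twins_limit_cofinal => m; exists (L (m + S n)%nat); split.
      have := Lge (m + S n)%nat; lia.
    rewrite Hc; have [E1 E2] := HW m.
    have -> : L (m + S n)%nat = (length (W m) + length (U (S n) (pre u (S n))))%nat.
      by rewrite UL E1; move: E2; rewrite E1; have := Llt n; case: m {Hu E1} => [|m] /=; lia.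
    rewrite pre_ap Hz; exact: Hu.
  rewrite (key x (fun j => proj1 (HT j))) (key y (fun j => proj2 (HT j))).
  by case: (Hf (S n)) => [[[_ H] _] _]; exact: (H _ _ (Htree O)).
Qed.

End Separation.

(** The zeros follow [nth_word n] and pad it to length [n]. Every word is thus extended by some
    member, as a G0 sequence requires. *)
Definition dense_word (n : nat) : word :=
  repeat false (n - length (nth_word n)) ++ nth_word n.

Lemma dense_word_length n : length (dense_word n) = n.
Proof. rewrite /dense_word length_app repeat_length; have := nth_word_length n; lia. Qed.

Lemma dense_word_ext w : exists n w', dense_word n = w' ++ w.
Proof. have [n <-] := nth_word_surj w; exists n; by eexists. Qed.

(** * Restriction to cones and the dichotomy *)

Definition restr {Y : Type} (h : (nat -> bool) -> Y) (w : word) := fun z => h (ap w z).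

Lemma restr_cont {Y : Polish} (h : (nat -> bool) -> Y) w :
  cantor_cont h -> cantor_cont (restr h w).
Proof.
move=> Hh z eps He; have [n Hn] := Hh (ap w z) eps He; exists n => z' Hz; apply: Hn.
elim: w z z' Hz {Hh} => //= e w IH z z' Hz; apply: IH => -[|i] Hi //=; apply: Hz; lia.
Qed.

Lemma restr_twins {Y : Type} (h : (nat -> bool) -> Y) w p q :
  twins (restr h w) p q <-> twins h (p ++ w) (q ++ w).
Proof. by split=> H z; have := H z; rewrite /restr !ap_app. Qed.

Lemma restr_linked {Y : Type} (h : (nat -> bool) -> Y) B w p q :
  linked (restr h w) B p q <-> linked h B (p ++ w) (q ++ w).
Proof. by split=> H z; have := H z; rewrite /restr !ap_app. Qed.

Lemma restr_dich {Y : Polish} (h : (nat -> bool) -> Y) w :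
  dichotomous h -> dichotomous (restr h w).
Proof.
move=> Hh s t E; case: (Hh (s ++ w) (t ++ w)); first by rewrite !length_app E.
  by left; apply/restr_twins.
by move=> H; right=> z z'; rewrite /restr -!ap_app; exact: H.
Qed.

Lemma restr_base {Y : Polish} (h : (nat -> bool) -> Y) B w p q :
  base (restr h w) B p q -> base h B (p ++ w) (q ++ w).
Proof.
move=> [E [/restr_linked L F]]; split; first by rewrite !length_app E.
split=> // v Hv Ht; apply: (F v).
  by move/restr_twins; rewrite /= -!app_assoc; exact: Hv.
by apply/restr_twins; rewrite /= -!app_assoc.
Qed.

Theorem theorem1p7 (Y : Polish) (B : Y -> Y -> Prop)
  (HB : digraph B) (Han : analytic_rel B) :
  let a := countable_borel_chromatic B in
  let b := exists (X : Polish) (f : nat -> pmap X),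
             complex_situation X f /\
             (inj_c_le (Af f) B \/ inj_c_le (Af f) (inv_rel B)) in
  (a \/ b) /\ ~ (a /\ b).
Proof.
move=> a b; split; last first.
  by move=> [Ha [X [f [HX Hf]]]]; exact: (not_countable_of_complex Y B X f HX Hf Ha).
case: (classic a) => [|Ha]; [by left|right].
have [Z [g1 [g2 [cg1 [cg2 HZ]]]]] := Han.
(* If [Z] is empty there are no edges and a constant colouring works. *)
case: (classic (inhabited Z)) => [[z0]|nZ]; last first.
  case: Ha; exists (fun _ => O); split=> [n|y y' /HZ [z]].
    by apply: borel_open => y E; exists 1; split; [lra|].
  by case: nZ.
have [h [h_cont [h_dich h_link]]] :=
  fusion (g1 z0) z0 B g1 g2 cg1 cg2 HZ dense_word dense_word_length Ha.
have HB' : digraph (inv_rel B) by exact: HB.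
case: (classic (forall w, exists u v, base h B (u ++ w) (v ++ w))) => H1.
  have [X [f [HX Hf]]] := complex_situation_of_base h h_cont h_dich B HB H1.
  by exists X, f; split=> //; left.
have [w1 Hw1] := not_all_ex_not _ _ H1.
pose h1 := restr h w1.
have c1 : cantor_cont h1 by exact: restr_cont.
have d1 : dichotomous h1 by exact: restr_dich.
case: (classic (forall w, exists u v, base h1 (inv_rel B) (u ++ w) (v ++ w))) => H2.
  have [X [f [HX Hf]]] := complex_situation_of_base h1 c1 d1 _ HB' H2.
  by exists X, f; split=> //; right.
have [w2 Hw2] := not_all_ex_not _ _ H2.
pose h2 := restr h1 w2.
have c2 : cantor_cont h2 by exact: restr_cont.
have d2 : dichotomous h2 by exact: restr_dich.
(* A base pair in the smaller cone would extend [w1], or [w2] for the reversed digraph, against the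
   choice of these words. *)
have n1 u v : ~ base h2 B u v.
  move=> /restr_base /restr_base H; apply: Hw1.
  by exists (u ++ w2), (v ++ w2).
have n2 u v : ~ base h2 (inv_rel B) u v.
  by move=> /restr_base H; apply: Hw2; exists u, v.
have notfwd u v B' : length u = length v -> linked h2 B' u v -> ~ base h2 B' u v ->
    exists w, splits h2 (w ++ v) /\ ~ splits h2 (w ++ u).
  move=> E L Hb; apply: NNPP => Hn; apply: Hb; split=> //; split=> // w Hv.
  by apply: NNPP => Hu; apply: Hn; exists w.
have [|u v E L|g [g_cont [g_inj g_link]]] :=
  injective_hom h2 B dense_word c2 d2 HB dense_word_length.
- move=> w; have [n [w' E]] := dense_word_ext ((w ++ w2) ++ w1).
  exists w'; have := h_link n; rewrite E => H.
  by apply/restr_linked/restr_linked; rewrite /= -!app_assoc in H *.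
- split; first exact: notfwd E L (n1 u v).
  by apply: (notfwd v u (inv_rel B)) => // z; exact: L.
(* As [g] is injective, distinct words of equal length are never twins. Hence every word splits and
   [forward] always holds. *)
have g_pre p q z z' : length p = length q -> g (ap p z) = g (ap q z') -> p = q.
  by move=> E /g_inj Eg; rewrite -(pre_ap0 p z) Eg E pre_ap0.
have [||X [f [HX Hf]]] := complex_situation_of_base g g_cont _ B HB.
- move=> p q E; case: (classic (p = q)) => [->|Hpq]; first by left.
  by right=> z z' /(g_pre _ _ _ _ E).
- move=> w; have [n [w' E]] := dense_word_ext w.
  exists (false :: w'), (true :: w'); split=> //; split.
    by have := h_link n; have := g_link n; rewrite E.
  by move=> v _ /(_ (fun _ => false)) /g_pre => /(_ erefl).
by exists X, f; split=> //; left.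
Qed.
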